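(* Let $G$ be a Polish groupoid, $(X,\tau)$ a Polish $G$-space, $V\subseteq G$ an open subset that is Polish in the relative topology, $1\le\alpha<\omega_1$, $P\subseteq X$ a $\mathbf{\Sigma}^0_\alpha$ set (with respect to $\tau$), and $Q=P^{\triangle V}$. Then there is a topology $t$ on $X$ such that: (1) $t$ is Polish; (2) $t$ is finer than $\tau$; (3) $Q$ is $t$-open; (4) the action of $G$ on $(X,t)$ is continuous (anchor map and action map continuous); (5) $t$ has a countable basis $\mathcal{B}$ such that every $B\in\mathcal{B}$ is $\mathbf{\Sigma}^0_{\alpha+n}$ with respect to $\tau$ for some $n\in\omega$.
   Context: A groupoid is a small category in which every arrow is invertible; $G^0$ objects, $s,r$ source and range. A topological space is locally Polish if it has a countable basis of open sets Polish in the relative topology. A Polish groupoid is a groupoid with a locally Polish topology such that composition and inversion are continuous and open, $G^0$ is Polish, and $s^{-1}(x)$, $r^{-1}(x)$ are Polish for all $x\in G^0$. A Polish $G$-space is a Polish space $X$ with a continuous anchor $p:X\to G^0$ and a continuous map $(\gamma,x)\mapsto\gamma x$ on $\{(\gamma,x):s(\gamma)=p(x)\}$ with $\gamma(\rho x)=(\gamma\rho)x$, $p(\gamma x)=r(\gamma)$, $p(x)x=x$. For $A\subseteq X$ and $V\subseteq G$, writing $Vp(x)=V\cap s^{-1}(p(x))$, the Vaught transform is $A^{\triangle V}=\{x\in X: Vp(x)\ne\varnothing$ and $\{\gamma\in Vp(x):\gamma x\in A\}$ is nonmeager in $Vp(x)\}$. *)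

(* Defs.v *)
From HB Require Import structures.
From mathcomp Require Import all_boot all_order all_algebra.
From mathcomp Require Import all_classical reals topology.

Set Implicit Arguments.
Unset Strict Implicit.
Unset Printing Implicit Defensive.

Local Open Scope classical_set_scope.

(* Completely metrizable and separable. [metricType] carries its own topology,
   so compatibility with that of [T] is required explicitly; the library's
   [completeType] is pointed, hence would exclude the empty space, so
   completeness is spelled out. The notion does not depend on which complete
   ordered field [R] the distances live in. *)
Definition polish (R : realType) (T : topologicalType) : Prop :=
  (exists2 D : set T, countable D & dense D) /\
  exists m : Metric R T, let M : metricType R := Metric.Pack m in
    (@open M = @open T) /\
    (forall F : set_system M, ProperFilter F -> cauchy F ->
       exists x : M, F --> x).

(* A set coerces to the corresponding subtype, with the relative topology. *)
Definition polish_set (R : realType) (T : topologicalType) (A : set T) : Prop :=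
  polish R (set_type A).

Definition locally_polish (R : realType) (T : topologicalType) : Prop :=
  exists2 B : set (set T), countable B &
    basis B /\ (forall U, B U -> polish_set R U).

Definition nowhere_dense (T : topologicalType) (A : set T) : Prop :=
  interior (closure A) = set0.

Definition meager (T : topologicalType) (A : set T) : Prop :=
  exists2 F : nat -> set T,
    (forall n, nowhere_dense (F n)) & A = \bigcup_n F n.

(* Countable ordinals, as well-founded countably branching trees:
   [om_sup f] denotes sup_n (f n + 1). Distinct trees may denote the same
   ordinal; [om_le] and [om_lt] compare the ordinals denoted (see
   [om_lt_represents]: every countable well-order is represented). *)
Inductive omega1 : Type :=
| om_zero : omega1
| om_sup : (nat -> omega1) -> omega1.

Fixpoint om_le (a b : omega1) : Prop :=
  match a, b with
  | om_zero, _ => True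
  | om_sup _, om_zero => False
  | om_sup f, om_sup g => forall n, exists m, om_le (f n) (g m)
  end.

Definition om_succ (a : omega1) : omega1 := om_sup (fun=> a).

Definition om_lt (a b : omega1) : Prop := om_le (om_succ a) b.

Definition om_one : omega1 := om_succ om_zero.

Definition om_addn (a : omega1) (n : nat) : omega1 := iter n om_succ a.

Lemma om_ltE a b :
  om_lt a b <-> exists2 g, b = om_sup g & exists m, om_le a (g m).
Proof.
case: b => [|g]; first by split=> // -[].
by split=> [/(_ 0%N) h|[_ [<-]] h]; [exists g|move=> n].
Qed.

Lemma om_le_refl a : om_le a a.
Proof. by elim: a => //= f IH n; exists n. Qed.

Lemma om_le_trans b a c : om_le a b -> om_le b c -> om_le a c.
Proof.
elim: a b c => [|f IH] [|g] [|h] //= fg gh n.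
by have [m fgm] := fg n; have [k ghk] := gh m; exists k; apply: IH fgm ghk.
Qed.

Lemma om_le_succ a : om_le a (om_succ a).
Proof.
elim: a => //= f IH n; exists 0%N; apply: om_le_trans (IH n) _.
by move=> _; exists n; exact: om_le_refl.
Qed.

Lemma om_lt_trans b a c : om_lt a b -> om_lt b c -> om_lt a c.
Proof.
by move=> ab bc; apply: om_le_trans ab (om_le_trans (om_le_succ b) bc).
Qed.

Lemma om_lt_irrefl a : ~ om_lt a a.
Proof.
elim: a => [|f IH] /om_ltE[//] g [<-] [m fm]; apply: (IH m).
by apply: om_le_trans fm => _; exists m; exact: om_le_refl.
Qed.

Lemma om_le_total a b : om_le a b \/ om_lt b a.
Proof.
elim: a b => [|f IH] b; first by left; case: b.
have [[n bn]|/forallNP nb] := pselect (exists n, om_le b (f n)).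
  by right; apply/om_ltE; exists f => //; exists n.
left; case: b nb => [|g] nb; first by case: (nb 0%N).
move=> n; apply: contrapT => /forallNP nfg; apply: (nb n).
have lt_gf m : om_lt (g m) (f n) by have [/nfg|] := IH n (g m).
case: (f n) lt_gf => [|h] lt_gh; first by have /om_ltE[] := lt_gh 0%N.
by move=> m; have /om_ltE[_ [<-]] := lt_gh m.
Qed.

Lemma om_lt_wf : well_founded om_lt.
Proof.
move=> a; suff: forall b, om_le b a -> Acc om_lt b by apply; exact: om_le_refl.
elim: a => [|f IH] b ba; constructor => c /om_ltE[g bE [m cm]].
  by rewrite bE in ba.
by move: ba; rewrite bE => /(_ m)[n gn]; apply: IH (om_le_trans cm gn).
Qed.

Lemma om_lt_represents (W : Type) (r : W -> W -> Prop) :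
  countable [set: W] -> well_founded r ->
  (forall x y z, r x y -> r y z -> r x z) ->
  (forall x y, [\/ r x y, x = y | r y x]) ->
  exists rk : W -> omega1, forall x y, r x y <-> om_lt (rk x) (rk y).
Proof.
move=> /pcard_leP[e] rwf rtrans rtot.
have inje : injective e by move=> x y /(@inj _ _ _ e); apply; rewrite inE.
pose step x (F : forall y, r y x -> omega1) : omega1 :=
  if pselect (exists y, r y x) then
    om_sup (fun n =>
      if pselect (exists y, r y x /\ e y = n) is left h
      then F (projT1 (cid h)) (projT2 (cid h)).1 else om_zero)
  else om_zero.
pose rk := Fix rwf (fun=> omega1) step.
have rkE x : rk x = step x (fun y _ => rk y).
  apply: (Fix_eq rwf (fun=> omega1) step) => z f g fg.
  by congr step; apply: functional_extensionality_dep => y; apply/funext=> yz.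
have up x y : r x y -> om_lt (rk x) (rk y).
  move=> xy; apply/om_ltE; rewrite (rkE y) /step.
  case: (pselect (exists z, r z y)) => [ex_pred|[]]; last by exists x.
  eexists; first by [].
  exists (e x); case: pselect => [h|[]]; last by exists x.
  by case: (cid h) => /= z [_ /inje ->]; exact: om_le_refl.
exists rk => x y; split; first exact: up.
case: (rtot x y) => // [->|yx]; first by move/om_lt_irrefl.
by move=> lt_xy; case: (om_lt_irrefl (om_lt_trans lt_xy (up _ _ yx))).
Qed.

(* Sigma^0_1 is the class of open sets; for alpha > 1, a Sigma^0_alpha set is
   a countable union of sets F n in Pi^0_(b n) with 1 <= b n < alpha. *)
Inductive Sigma0 (T : topologicalType) : omega1 -> set T -> Prop :=
| Sigma0_open (a : omega1) (A : set T) :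
    om_le a om_one -> om_le om_one a -> open A -> Sigma0 a A
| Sigma0_bigcup (a : omega1) (b : nat -> omega1) (F : nat -> set T) :
    (forall n, om_le om_one (b n) /\ om_lt (b n) a) ->
    (forall n, Sigma0 (b n) (~` F n)) ->
    Sigma0 a (\bigcup_n F n).

Lemma Sigma0_eqv (T : topologicalType) (a a' : omega1) (A : set T) :
  om_le a a' -> om_le a' a -> Sigma0 a A -> Sigma0 a' A.
Proof.
move=> aa' a'a aA; case: aA aa' a'a => {a A} [a A a1 a1' oA|a b F ba bF] aa' a'a.
  by apply: Sigma0_open => //; [exact: om_le_trans a1|exact: om_le_trans aa'].
apply: (Sigma0_bigcup _ bF) => n; have [b1 lt_ba] := ba n.
by split=> //; exact: om_le_trans aa'.
Qed.

(* A groupoid is given by its set [G] of arrows, each object being identified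
   with its identity arrow; [g * h] is defined when [src g = rng h], and the
   values of the total function [comp] elsewhere are irrelevant. *)
Record groupoid (G : Type) := Groupoid {
  src : G -> G;
  rng : G -> G;
  comp : G -> G -> G;
  ginv : G -> G;
  src_src : forall g, src (src g) = src g;
  rng_src : forall g, rng (src g) = src g;
  src_rng : forall g, src (rng g) = rng g;
  rng_rng : forall g, rng (rng g) = rng g;
  src_comp : forall g h, src g = rng h -> src (comp g h) = src h;
  rng_comp : forall g h, src g = rng h -> rng (comp g h) = rng g;
  compA : forall g h k, src g = rng h -> src h = rng k ->
    comp g (comp h k) = comp (comp g h) k;
  comp_src : forall g, comp g (src g) = g;
  comp_rng : forall g, comp (rng g) g = g;
  src_ginv : forall g, src (ginv g) = rng g;
  rng_ginv : forall g, rng (ginv g) = src g;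
  comp_ginvr : forall g, comp g (ginv g) = rng g;
  comp_ginvl : forall g, comp (ginv g) g = src g
}.

Definition objects (G : Type) (gd : groupoid G) : set G :=
  [set x | src gd x = x].

Definition composable (G : Type) (gd : groupoid G) : set (G * G) :=
  [set gh | src gd gh.1 = rng gd gh.2].

Record polish_groupoid (R : realType) (G : topologicalType)
    (gd : groupoid G) : Prop := {
  pgpd_locally_polish : locally_polish R G;
  pgpd_comp_continuous :
    {within composable gd, continuous (fun gh => comp gd gh.1 gh.2)};
  pgpd_comp_open : forall W : set (G * G), open W ->
    open ((fun gh => comp gd gh.1 gh.2) @` (W `&` composable gd));
  pgpd_inv_continuous : continuous (ginv gd);
  pgpd_inv_open : forall W : set G, open W -> open (ginv gd @` W);
  pgpd_objects_polish : polish_set R (objects gd);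
  pgpd_src_polish : forall x, objects gd x ->
    polish_set R (src gd @^-1` [set x]);
  pgpd_rng_polish : forall x, objects gd x ->
    polish_set R (rng gd @^-1` [set x])
}.

(* As for [comp], the values of [act g x] matter only when [src g = p x]. *)
Record groupoid_action (G X : Type) (gd : groupoid G)
    (p : X -> G) (act : G -> X -> X) : Prop := {
  gact_anchor_objects : forall x, objects gd (p x);
  gact_comp : forall g h x, src gd g = rng gd h -> src gd h = p x ->
    act g (act h x) = act (comp gd g h) x;
  gact_anchor : forall g x, src gd g = p x -> p (act g x) = rng gd g;
  gact_id : forall x, act (p x) x = x
}.

Record continuous_action (G X : topologicalType) (gd : groupoid G)
    (p : X -> G) (act : G -> X -> X) : Prop := {
  cact_anchor : continuous p;
  cact_act : {within [set gx : G * X | src gd gx.1 = p gx.2],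
    continuous (fun gx => act gx.1 gx.2)}
}.

Record polish_gspace (R : realType) (G X : topologicalType) (gd : groupoid G)
    (p : X -> G) (act : G -> X -> X) : Prop := {
  pgsp_polish : polish R X;
  pgsp_action : groupoid_action gd p act;
  pgsp_continuous : continuous_action gd p act
}.

Definition fiber (G X : Type) (gd : groupoid G) (p : X -> G)
    (V : set G) (x : X) : set G :=
  V `&` src gd @^-1` [set p x].

(* Meagerness is relative to the subspace [fiber gd p V x]. *)
Definition vaught (G : topologicalType) (X : Type) (gd : groupoid G)
    (p : X -> G) (act : G -> X -> X) (A : set X) (V : set G) : set X :=
  [set x | fiber gd p V x !=set0 /\
     ~ meager [set g : set_type (fiber gd p V x) | A (act (val g) x)]].

(* Main.v *)
Require Import Defs.
From HB Require Import structures.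
From mathcomp Require Import all_boot all_order all_algebra.
From mathcomp Require Import lra.
From mathcomp Require Import all_classical reals interval_inference topology.
From mathcomp Require Import normedtype sequences.

(* The topology t has the sets B^{triangle U} as a basis, for U in a countable basis of G and B in
   a countable family of Borel sets that contains P and a basis of tau, is closed under
   complements, intersections and the transforms B^{triangle U}, and with each B also contains
   sets of lower rank witnessing that B is Borel. Continuity of composition shows that the
   action is continuous for t. Closure under complements and transforms makes t regular: the
   points x with g x in B^{triangle U} for comeagerly many g near p(x) form a t-closed set.
   For complete metrizability one uses a forcing-like argument instead of Choquet's theorem:
   a "theory" is a filter of basic t-open sets obeying countably many covering rules. From it
   one chooses a decreasing sequence of conditions (B_n, U_n); the U_n shrink to an arrow g, the
   B_n shrink to a point y generic for the family, and g^{-1} y realizes the theory.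
   The classes Sigma^0_beta are preserved by the transforms because Borel sets have the Baire
   property in the fibers of the source map. *)

Set Implicit Arguments.
Unset Strict Implicit.
Unset Printing Implicit Defensive.

Import Order.TTheory GRing.Theory Num.Theory.
Import numFieldNormedType.Exports.

Local Open Scope classical_set_scope.
Local Open Scope ring_scope.

(** Dependent choice. The relation depends on the stage so that a construction can work through an
    enumeration. *)
Lemma dependent_sequence (A : Type) (Inv : A -> Prop) (rel : nat -> A -> A -> Prop) (a0 : A) :
  Inv a0 -> (forall n a, Inv a -> exists a', Inv a' /\ rel n a a') ->
  exists f : nat -> A, [/\ f 0%N = a0, forall n, Inv (f n) & forall n, rel n (f n) (f n.+1)].
Proof.
move=> I0 step; have /choice[nx nxP] : forall na : nat * A, exists a', Inv na.2 ->
    Inv a' /\ rel na.1 na.2 a'.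
  move=> [n a]; have [Ia|nI] := pselect (Inv a); last by exists a0.
  by have [a' a'P] := step n a Ia; exists a'.
pose f := fix f n := if n is m.+1 then nx (m, f m) else a0.
have fI n : Inv (f n) by elim: n => //= n IH; have [] := nxP (n, f n) IH.
by exists f; split=> // n; have [] := nxP (n, f n) (fI n).
Qed.

(** * Polish spaces *)

Lemma basisP (T : topologicalType) (B : set (set T)) :
  basis B <-> (B `<=` open /\
    forall x (O : set T), open O -> O x -> exists2 U, B U & U x /\ U `<=` O).
Proof.
split=> -[Bo Bb]; split=> //.
  move=> x O Oo Ox; have [U [BU Ux] UO] := Bb x O (open_nbhs_nbhs (conj Oo Ox)).
  by exists U.
move=> x N; rewrite nbhsE => -[O [Oo Ox] ON].
by have [U BU [Ux UO]] := Bb x O Oo Ox; exists U => //; exact: subset_trans ON.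
Qed.

Lemma second_countable_dense (T : topologicalType) :
  @second_countable T -> exists2 D : set T, countable D & dense D.
Proof.
move=> [B Bc /basisP[Bo Bb]].
(* The option type is used because [T] may be empty, in which case no default point exists. *)
have [f fP] : exists f : set T -> option T, forall U x, U x ->
    exists2 y, f U = Some y & U y.
  suff /choice[f fP] : forall U : set T, exists o : option T, forall x, U x ->
      exists2 y, o = Some y & U y by exists f.
  move=> U.
  have [[x Ux]|n0] := pselect (U !=set0); first by exists (Some x) => y _; exists x.
  by exists None => x Ux; case: n0; exists x.
exists (\bigcup_(U in B) [set y | f U = Some y]).
  apply: bigcup_countable => // U _; case: (f U) => [y|].
    apply: sub_countable (countable1 y); apply: subset_card_le => z /=.
    by case.
  by rewrite (_ : [set _ | _] = set0) ?countable0// -subset0 => z.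
move=> O [x Ox] Oo; have [U BU [Ux UO]] := Bb x O Oo Ox.
have [y fU Uy] := fP U x Ux; exists y; split; [exact: UO|by exists U].
Qed.

Lemma polish_of_dist (R : realType) (Y : topologicalType) (d : Y -> Y -> R) :
  @second_countable Y ->
  (forall x, d x x = 0) -> (forall x y, d x y = 0 -> x = y) ->
  (forall x y, d x y = d y x) -> (forall y x z, d x z <= d x y + d y z) ->
  (forall x e, 0 < e -> nbhs x [set y | d x y < e]) ->
  (forall x A, nbhs x A -> exists2 e, 0 < e & [set y | d x y < e] `<=` A) ->
  (forall F : set_system Y, ProperFilter F ->
    (forall e, 0 < e -> exists x, F [set y | d x y < e]) ->
    exists x : Y, F --> x) ->
  polish R Y.
Proof.
move=> Y2 d0 dpos dC dtri nd dn dcomp; split; first exact: second_countable_dense.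
pose mm := isMetric.Build R Y d0 dpos dC dtri.
pose M : metricType R := HB.pack (Y : Type) (Choice.on Y) mm.
have bE (x : Y) e : @ball R M x e = [set y | d x y < e] by [].
have nE (x : Y) : @nbhs M M x = @nbhs Y Y x.
  apply/seteqP; split => A.
    move=> /nbhs_ballP[e/= e0 eA]; apply: filterS (nd x e e0).
    by move=> y xy; apply: eA; move: xy.
  move=> /dn [e epos esub]; apply/nbhs_ballP; exists e; first exact: epos.
  exact: esub.
exists (Metric.class M) => /=; split.
  rewrite !openE; apply/seteqP; split => A Ao x /Ao; rewrite /interior.
    by rewrite /= nE.
  by rewrite /= -nE.
move=> F FF Fc; have [|x Fx] := dcomp F FF.
  move=> e e0; have /cauchyP := Fc; move=> /(_ e e0) [x Fx]; exists x.
  by rewrite -bE.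
by exists x => A; rewrite /= nE => /Fx.
Qed.

(* [prec n A B] abstracts "[A] has diameter less than [1 / n.+1] and a uniform
   neighborhood of [A] lies in [B]". *)
Definition sieve_complete (T : topologicalType) (S : set T) :=
  exists prec : nat -> set T -> set T -> Prop,
  [/\ forall n A B, prec n A B -> A `<=` B,
      forall n B z, open B -> B z -> S z ->
        exists2 O, open O & O z /\ forall A, A `<=` O -> prec n A B &
      forall A : nat -> set T, (forall n, A n `&` S !=set0) ->
        (forall n, prec n (A n.+1) (A n)) ->
        exists2 z, S z & (forall n, A n z) /\
          forall O, open O -> O z -> exists n, A n `&` S `<=` O].

(** Working with a map [f] that induces the topology of [M] treats subspaces and whole spaces at
    once. *)
Lemma sieve_complete_polish R (M T : topologicalType) (f : M -> T) :
  polish R M ->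
  (forall A : set M, open A <-> exists2 B : set T, open B & f @^-1` B = A) ->
  sieve_complete (range f).
Proof.
move=> [_ [mt]]; set M' := Metric.Pack mt => -[oE Mc] fo.
pose bal (x : M) (e : R) : set M := @ball R M' x e.
exists (fun n A B => A `<=` B /\
  (exists2 e : R, 0 < e & forall x y, A (f x) -> bal x e y -> B (f y)) /\
  forall x y, A (f x) -> A (f y) -> bal x (n.+1%:R^-1) y).
split; first by move=> n A B [].
- move=> n B fz Bo Bz [z _ zE].
  have : @nbhs M' M' z (f @^-1` B).
    apply: open_nbhs_nbhs; split; last by rewrite /= zE.
    by rewrite oE; apply/fo; exists B.
  move=> /nbhs_ballP[e /= e0 eB].
  (* Half of each bound: two points of the ball of radius [r] are then within [1/(n+1)], and its
     [e/2]-neighborhood stays inside the ball of radius [e]. *)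
  pose r := Num.min (e / 2) (n.+1%:R^-1 / 2).
  have r0 : 0 < r by rewrite lt_min !divr_gt0 ?invr_gt0 ?ltr0n.
  have : @open M' (@interior M' (bal z r)) by exact: open_interior.
  rewrite oE => /fo[O Oo OE]; exists (O `&` B); first exact: openI.
  have sub x : O (f x) -> bal z r x.
    by move=> Ox; apply: (@interior_subset M'); rewrite -OE.
  split.
    split=> //; rewrite -zE -[O (f z)]/((f @^-1` O) z) OE.
    have : @nbhs M' M' z (bal z r) by exact: nbhsx_ballx.
    by [].
  move=> A AO; split; first by move=> t /AO[].
  split.
    exists (e / 2); first by rewrite divr_gt0.
    move=> x y /AO[/sub zx _] xy; apply: eB.
    apply: (@le_ball _ M' z (r + e / 2)).
      by rewrite [leRHS](splitr e) lerD2r /r ge_min lexx.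
    exact: ball_triangle xy.
  move=> x y /AO[/sub zx _] /AO[/sub zy _].
  apply: (@le_ball _ M' x (r + r)).
    by rewrite [leRHS](splitr _) lerD // /r ge_min lexx orbT.
  exact: ball_triangle (ball_sym zx) zy.
move=> A A0 Ap.
have AS n m : (n <= m)%N -> A m `<=` A n.
  elim: m => [|m IH]; first by rewrite leqn0 => /eqP->.
  rewrite leq_eqVlt => /orP[/eqP->//|]; rewrite ltnS => /IH; apply: subset_trans.
  by have [] := Ap m.
pose F := filter_from setT (fun n => f @^-1` A n).
have FF : ProperFilter F.
  apply: filter_from_proper; last first.
    by move=> n _; have [t [An [x _ xE]]] := A0 n; exists x; rewrite /= xE.
  apply: filter_fromT_filter; first by exists 0%N.
  move=> i j; exists (maxn i j) => x Ax; split; apply: AS Ax.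
    exact: leq_maxl.
  exact: leq_maxr.
have [|z Fz] := Mc F FF.
  apply/cauchyP => e e0.
  have [n ne] : exists n, (n.+1%:R^-1 : R) < e.
    near \oo => n; exists n; near: n.
    exact: (near_infty_natSinv_lt (PosNum e0)).
  have [t [An [x _ xE]]] := A0 n.+1.
  exists x; exists n.+1 => // y Ay.
  have [_ [_ /(_ x y)]] := Ap n; rewrite xE => /(_ An Ay).
  by apply: le_ball; exact: ltW.
exists (f z); first by exists z.
split.
  (* The sets need not be closed: [z] lies in [A n] because a uniform neighborhood of [A n.+1]
     does. *)
  move=> n; have [_ [[e e0 eB] _]] := Ap n.
  have [k _ kz] := Fz _ (nbhsx_ballx (z : M') e e0).
  have [t [An [x _ xE]]] := A0 (maxn k n.+1).
  apply: (eB x); first by rewrite xE; apply: AS An; exact: leq_maxr.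
  apply: ball_sym; apply: kz; rewrite /= xE; apply: AS An; exact: leq_maxl.
move=> O Oo Oz.
have : @nbhs M' M' z (f @^-1` O).
  by apply: open_nbhs_nbhs; split=> //; rewrite oE; apply/fo; exists O.
move=> /Fz[n _ nO]; exists n => t [An [x _ xE]]; rewrite -xE; apply: nO.
by rewrite /= xE.
Unshelve. all: by end_near.
Qed.

Lemma sieve_complete_set R (T : topologicalType) (S : set T) :
  polish_set R S -> sieve_complete S.
Proof.
move=> pS; have -> : S = range (set_val : S -> T).
  apply/seteqP; split=> [x Sx|_ [[x xS] _ <-]]; last by rewrite set_valE; exact: set_mem.
  by exists (exist _ x (mem_set Sx)).
apply: (sieve_complete_polish pS) => A.
by split=> -[B Bo BA]; exists B.
Qed.

Lemma sieve_complete_space R (T : topologicalType) :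
  polish R T -> sieve_complete [set: T].
Proof.
move=> pT; have -> : setT = range (@id T) by rewrite image_id.
by apply: (sieve_complete_polish pT) => A; split=> [|[B Bo <-]] //; exists A.
Qed.

(** * Distances from families of functions *)

Definition indexed_basis (T : topologicalType) (I : Type) (W : I -> set T) :=
  (forall i, open (W i)) /\
  forall x O, open O -> O x -> exists2 i, W i x & W i `<=` O.

Lemma indexed_basis_second_countable (T : topologicalType) (I : countType)
  (W : I -> set T) : indexed_basis W -> @second_countable T.
Proof.
move=> [Wo Wb]; exists (range W).
  by apply: sub_countable (countableP [set: I]); exact: card_image_le.
apply/basisP; split=> [_ [i _ <-]//|x O Oo Ox].
by have [i Wi WiO] := Wb x O Oo Ox; exists (W i) => //; exists i.
Qed.

Lemma countable_basis_indexed (T : topologicalType) (B : set (set T)) :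
  countable B -> basis B ->
  exists2 W : nat -> set T, indexed_basis W & forall n, B (W n) \/ W n = set0.
Proof.
move=> Bc /basisP[Bo Bb].
have [f fB] : exists f : nat -> set T, B `<=` range f.
  have [->|/set0P[U0 _]] := eqVneq B set0; first by exists (fun=> set0).
  move/pfcard_geP: Bc => [B0|/unsquash f]; first by exists (fun=> U0); rewrite B0.
  by exists f => V BV; have [n _ fn] := @surj _ _ _ _ f V BV; exists n.
exists (fun n => if pselect (B (f n)) then f n else set0); last first.
  by move=> n; case: pselect => [b|nb] /=; [left|right].
split=> [n|x O Oo Ox].
  by case: pselect => [/Bo//|nB] /=; exact: open0.
have [V BV [Vx VO]] := Bb x O Oo Ox; have [n _ fn] := fB V BV.
by exists n; case: pselect => [b|] /=; rewrite fn.
Qed.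

Lemma polish_basis (R : realType) (T : topologicalType) : polish R T ->
  exists W : nat -> set T, indexed_basis W.
Proof.
move=> [[D Dc Dd] [mt]]; set M := Metric.Pack mt => -[oE _].
pose bal (x : T) n : set T := @interior M (@ball R M x n.+1%:R^-1).
have bo x n : open (bal x n) by rewrite -oE; exact: (@open_interior M).
suff [W Wb _] : exists2 W : nat -> set T, indexed_basis W &
  forall n, [set bal dn.1 dn.2 | dn in D `*` setT] (W n) \/ W n = set0 by exists W.
apply: countable_basis_indexed.
  apply: sub_countable (countableX Dc (countableP setT)); exact: card_image_le.
apply/basisP; split=> [_ [[x n] _ <-]|x O Oo Ox]; first exact: bo.
have : @nbhs M M x O by apply: open_nbhs_nbhs; split=> //; rewrite oE.
move=> /nbhs_ballP[e /= e0 eO].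
have e20 : 0 < e / 2 by rewrite divr_gt0.
have [n ne] : exists n, (n.+1%:R^-1 : R) < e / 2.
  near \oo => n; exists n; near: n.
  exact: (near_infty_natSinv_lt (PosNum e20)).
have n0 k : 0 < k.+1%:R^-1 :> R by rewrite invr_gt0 ltr0n.
have n20 : 0 < n.+1%:R^-1 / 2 :> R by rewrite divr_gt0.
(* The center is taken within half the radius [u = 1/(n+1)] of [x]: the ball of radius [u] about it
   contains a neighborhood of [x] and lies in the ball about [x] of radius [3u/2 < e]. *)
pose N : set T := @interior M (@ball R M x (n.+1%:R^-1 / 2)).
have [y [Ny Dy]] : N `&` D !=set0.
  apply: Dd; last by rewrite -oE; exact: (@open_interior M).
  by exists x; exact: (@nbhsx_ballx R M x _ n20).
have xy : @ball R M x (n.+1%:R^-1 / 2) y by exact: (@interior_subset M).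
exists (bal y n); first by exists (y, n).
split.
  have : @nbhs M M x (@ball R M x (n.+1%:R^-1 / 2)) by exact: (@nbhsx_ballx R M x _ n20).
  apply: (@filterS M) => z xz; rewrite (splitr (n.+1%:R^-1)).
  exact: ball_triangle (ball_sym xy) xz.
move=> z /(@interior_subset M) yz; apply: eO.
apply: (@le_ball _ M x (n.+1%:R^-1 / 2 + n.+1%:R^-1)); last exact: ball_triangle yz.
move: (n0 n) ne; set u := n.+1%:R^-1; lra.
Unshelve. all: by end_near.
Qed.

Lemma polish_regular (R : realType) (T : topologicalType) : polish R T -> regular_space T.
Proof.
move=> [_ [mt]]; set M := Metric.Pack mt => -[oE _].
have nE (x : T) : @nbhs M M x = @nbhs T T x.
  by rewrite !nbhsE /open_nbhs /= oE.
move=> x N Nx; have : @nbhs M M x N by rewrite nE.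
move=> /(@uniform_regular M)[N' N'x N'N].
exists N'; first by rewrite -nE.
by move=> y yc; apply: N'N => B; rewrite nE; exact: yc.
Qed.

Lemma polish_hausdorff (R : realType) (T : topologicalType) : polish R T -> hausdorff_space T.
Proof.
move=> [_ [mt]]; set M := Metric.Pack mt => -[oE _].
have nE (x : T) : @nbhs M M x = @nbhs T T x.
  by rewrite !nbhsE /open_nbhs /= oE.
move=> x y xy; apply: (@metric_hausdorff R M) => A B; rewrite !nE; exact: xy.
Qed.

Lemma regular_open_basis (T : topologicalType) (I : Type) (W : I -> set T) :
  indexed_basis W -> regular_space T ->
  forall x O, open O -> O x -> exists2 i, W i x & closure (W i) `<=` O.
Proof.
move=> [Wo Wb] reg x O Oo Ox; have [N xN NO] := reg x O (open_nbhs_nbhs (conj Oo Ox)).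
have [i Wi WiN] := Wb x _ (open_interior N) xN.
exists i => //; apply: subset_trans NO; apply: closureS.
by apply: subset_trans WiN _; exact: interior_subset.
Qed.

(** Tychonoff's argument: each closed set is covered by countably many basic sets whose closures
    miss the other closed set, and from each of these the closures of the earlier ones of the other
    side are removed. *)
Lemma regular_normal (R : realType) (T : topologicalType) (I : countType)
    (W : I -> set T) : indexed_basis W -> regular_space T -> normal_space T.
Proof.
move=> Wb reg; have [Wo _] := Wb; have Wc := regular_open_basis Wb reg.
pose w n := if unpickle n is Some i then W i else set0.
have wo n : open (w n) by rewrite /w; case: unpickle => [i|]; [exact: Wo|exact: open0].
pose cut (D : set T) n := \bigcup_(k < n.+1)
  (if `[< closure (w k) `&` D = set0 >] then closure (w k) else set0).
have cutcl D n : closed (cut D n).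
  rewrite /cut bigcup_mkord; elim/big_rec : _ => [|i A _ Ac]; first exact: closed0.
  apply: closedU => //; case: ifP => // _; [exact: closed_closure|exact: closed0].
have cutD D n : cut D n `&` D = set0.
  rewrite -subset0 => x [[k _]]; case: ifP => // /asboolP <- ? ?; by split.
pose half (A B : set T) := \bigcup_(n in [set n | closure (w n) `&` B = set0])
  (w n `\` cut A n).
have halfo A B : open (half A B).
  apply: bigcup_open => n _; rewrite setDE; apply: openI; first exact: wo.
  exact/closed_openC/cutcl.
have halfs A B : closed B -> A `&` B = set0 -> A `<=` half A B.
  move=> Bc AB x Ax.
  have [|i Wi WiB] := Wc x (~` B) (closed_openC Bc).
    by move=> Bx; have : (A `&` B) x by []; rewrite AB.
  exists (pickle i) => /=; first by rewrite /w pickleK; apply/disjoints_subset.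
  split; first by rewrite /w pickleK.
  by move=> cx; have : (cut A (pickle i) `&` A) x by []; rewrite cutD.
apply/(@normal_openP R) => A B Ac Bc AB.
exists (half A B), (half B A); split; [exact: halfo|exact: halfo|exact: halfs| |].
  by apply: halfs => //; rewrite setIC.
rewrite -subset0 => x [[n /= nB [wn ncut]] [m /= mA [wm mcut]]].
(* The basic set with the smaller index was removed from the other one; equal indices are covered
   because [cut] includes its last index. *)
have [nm|mn] := leqP n m.
  apply: mcut; exists n => //=.
  by case: asboolP => // _; exact: subset_closure.
apply: ncut; exists m; first exact: (leqW mn).
by case: asboolP => // _; exact: subset_closure.
Qed.

Section family_distance.
Context (R : realType) (Y : Type) (K : countType) (f : K -> Y -> R).

(** The cap [2^-k] on the coordinate with code [k] leaves only finitely many coordinates relevant at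
    a given scale. Each term is a pseudometric, so a supremum can replace the usual series. *)
Definition fterm (x y : Y) (k : K) : R := Num.min (2^-1 ^+ pickle k) `|f k x - f k y|.

Definition fdist (x y : Y) : R := sup (range (fterm x y)).

Lemma fterm_le1 x y k : fterm x y k <= 1.
Proof. by rewrite /fterm ge_min exprn_ile1// invf_le1// ler1n. Qed.

Lemma fterm_le_fdist x y k : fterm x y k <= fdist x y.
Proof.
apply: ub_le_sup; last by exists k.
by exists 1 => r [j _ <-]; exact: fterm_le1.
Qed.

Lemma fdist_le x y e : 0 <= e -> (forall k, fterm x y k <= e) -> fdist x y <= e.
Proof.
move=> e0 fe; have [[k _]|n0] := pselect ([set: K] !=set0).
  by apply: ge_sup; [exists (fterm x y k), k|move=> r [j _ <-]].
rewrite /fdist (_ : range _ = set0) ?sup0// -subset0 => r [k _ _].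
by case: n0; exists k.
Qed.

Lemma fdist_ge0 x y : 0 <= fdist x y.
Proof.
have [[k _]|n0] := pselect ([set: K] !=set0).
  by apply: le_trans (fterm_le_fdist x y k); rewrite le_min exprn_ge0 ?normr_ge0 ?invr_ge0.
rewrite /fdist (_ : range _ = set0) ?sup0// -subset0 => r [k _ _].
by case: n0; exists k.
Qed.

Lemma fdistxx x : fdist x x = 0.
Proof.
apply/le_anti; rewrite fdist_ge0 andbT; apply: fdist_le => // k.
by rewrite /fterm subrr normr0 ge_min lexx orbT.
Qed.

Lemma fdistC x y : fdist x y = fdist y x.
Proof.
by rewrite /fdist (_ : fterm x y = fterm y x)//; apply/funext => k; rewrite /fterm distrC.
Qed.

Lemma fdist_triangle y x z : fdist x z <= fdist x y + fdist y z.
Proof.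
apply: fdist_le => [|k]; first by rewrite addr_ge0// fdist_ge0.
apply: le_trans (lerD (fterm_le_fdist x y k) (fterm_le_fdist y z k)).
rewrite /fterm; set a := 2^-1 ^+ _; have a0 : 0 <= a by rewrite exprn_ge0 ?invr_ge0.
have := ler_distD (f k y) (f k x) (f k z).
have := normr_ge0 (f k x - f k y); have := normr_ge0 (f k y - f k z).
rewrite !minEle; do !case: ifPn; rewrite -?ltNge; lra.
Qed.

Lemma fdist_lt x y k e : fdist x y < e -> e <= 2^-1 ^+ pickle k -> `|f k x - f k y| < e.
Proof.
move=> xy ek; have := le_lt_trans (fterm_le_fdist x y k) xy.
by rewrite gt_min ltNge ek.
Qed.

End family_distance.

Lemma fdist_nbhs (R : realType) (Y : topologicalType) (K : countType)
    (f : K -> Y -> R) (x : Y) (e : R) :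
  (forall k, continuous (f k)) -> 0 < e -> nbhs x [set y | fdist f x y < e].
Proof.
move=> fc e0; have e20 : 0 < e / 2 by rewrite divr_gt0.
(* Only the finitely many coordinates with code below [N] are controlled by continuity; a number
   that codes no index adds no constraint. *)
have : forall N, nbhs x [set y | forall k, (pickle k < N)%N -> `|f k x - f k y| < e / 2].
  elim=> [|N IH]; first by near=> y => k.
  case kN: (unpickle N : option K) => [k|].
    have : nbhs x [set y | `|f k x - f k y| < e / 2].
      by have /cvgrPdist_lt := fc k x; exact.
    move=> /(filterI IH); apply: filterS => y /= [H1 H2] j.
    rewrite ltnS leq_eqVlt => /orP[/eqP jN|]; last exact: H1.
    by move: kN; rewrite -jN pickleK => -[->].
  apply: filterS IH => y H1 j.
  rewrite ltnS leq_eqVlt => /orP[/eqP jN|]; last exact: H1.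
  by move: kN; rewrite -jN pickleK.
have [N Ne] : exists N, (2^-1 : R) ^+ N < e / 2.
  have : (2^-1 : R) ^+ n @[n --> \oo] --> 0.
    by apply: cvg_expr; rewrite ger0_norm// invf_lt1// ltr1n.
  move=> /cvgrPdist_lt /(_ _ e20) [N _ /(_ N (leqnn N))] /=.
  by rewrite sub0r normrN ger0_norm ?exprn_ge0//; exists N.
move=> /(_ N); apply: filterS => y /= H.
apply: (@le_lt_trans _ _ (e / 2)); last by rewrite ltr_pdivrMr// ltr_pMr// ltr1n.
apply: fdist_le => [|k]; first exact: ltW.
rewrite /fterm ge_min; have [kN|Nk] := ltnP (pickle k) N.
  by apply/orP; right; apply: ltW; exact: H.
apply/orP; left; apply: le_trans (ltW Ne).
by rewrite ler_wiXn2l// ?invf_le1// ler1n.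
Unshelve. all: by end_near.
Qed.

(** * Polishness from covering conditions *)

Section depth.
Context (R : realType) (Y : topologicalType) (d : Y -> Y -> R).
Hypothesis dxx : forall x, d x x = 0.
Hypothesis dC : forall x y, d x y = d y x.
Hypothesis dtri : forall y x z, d x z <= d x y + d y z.
Hypothesis dnbhs : forall x e, 0 < e -> nbhs x [set y | d x y < e].
Implicit Types (C : set (set Y)) (A : set Y).

(** A local Lebesgue number: the supremum of the radii, at most 1, of balls about [y] contained in a
    single member of [C]. Adjoining 0 keeps the supremum meaningful when [C] is empty. *)
Definition depth C y : R :=
  sup (0 |` [set r | 0 <= r <= 1 /\ exists2 A, C A & forall z, d y z < r -> A z]).

Let depth_has_sup C y :
  has_sup (0 |` [set r | 0 <= r <= 1 /\ exists2 A, C A & forall z, d y z < r -> A z]).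
Proof.
split; first by exists 0; left.
by exists 1 => r [->//|[/andP[]]].
Qed.

Lemma depth_ge C A y r : 0 <= r <= 1 -> C A -> (forall z, d y z < r -> A z) ->
  r <= depth C y.
Proof.
move=> r01 CA rA; apply: ub_le_sup; first by have [] := depth_has_sup C y.
by right; split=> //; exists A.
Qed.

Lemma depth_ge0 C y : 0 <= depth C y.
Proof.
by apply: ub_le_sup; [have [] := depth_has_sup C y|left].
Qed.

Lemma depth_gt C y e : 0 <= e -> e < depth C y ->
  exists2 A, C A & forall z, d y z < e -> A z.
Proof.
move=> e0 /(sup_gt (proj1 (depth_has_sup C y)))[r [->|[_ [A CA rA]] er]].
  by rewrite ltNge e0.
by exists A => // z yz; apply: rA; exact: lt_trans er.
Qed.

(** The ball of radius [r] about [y] contains the ball of radius [r - d y z] about [z]. *)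
Lemma depth_lipschitz C y z : depth C y <= depth C z + d y z.
Proof.
have d0 : 0 <= d y z.
  by have := dtri z y y; rewrite dxx (dC z y); lra.
apply: ge_sup; first by have [] := depth_has_sup C y.
move=> r [->|[/andP[r0 r1] [A CA rA]]]; first by rewrite addr_ge0 ?depth_ge0.
rewrite -lerBlDr; have [rd|dr] := ltP (r - d y z) 0.
  exact: le_trans (ltW rd) (depth_ge0 _ _).
apply: (@depth_ge C A) => //; first by rewrite dr; lra.
move=> t zt; apply: rA; have := dtri z y t; lra.
Qed.

Lemma depth_continuous C : continuous (depth C).
Proof.
move=> y; apply/cvgrPdist_lt => e e0; apply: filterS (dnbhs y e0) => z /= yz.
have := depth_lipschitz C y z; have := depth_lipschitz C z y; rewrite (dC z y).
by move=> ? ?; rewrite ltr_norml; apply/andP; split; lra.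
Qed.

(* The cutoff [m.+1%:R^-1] keeps the quotient continuous where the denominator vanishes. *)
Definition depth_ratio A C m y : R :=
  let a := depth [set A] y - m.+1%:R^-1 in (a + `|a|) / depth C y.

Lemma depth_mem A y : 0 < depth [set A] y -> A y.
Proof.
move=> dA0; have [||_ -> rA] := @depth_gt [set A] y (depth [set A] y / 2); try lra.
by apply: rA; rewrite dxx; lra.
Qed.

(** At a zero [y] of the denominator, [y] is outside [A]; the depth in [A] is then 0 at [y] and
    stays below the cutoff nearby, where the numerator [a + |a|] therefore vanishes. *)
Lemma depth_ratio_continuous A C m :
  (forall x, A x ->
    exists2 U, C U & exists2 e, 0 < e & [set y | d x y < e] `<=` U) ->
  continuous (depth_ratio A C m).
Proof.
move=> AC y; have [dC0|dC0] := ltP 0 (depth C y).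
  apply: cvgM; last first.
    by apply: cvgV; [rewrite gt_eqF|exact: depth_continuous].
  have ac : depth [set A] z - m.+1%:R^-1 @[z --> y] --> depth [set A] y - m.+1%:R^-1.
    by apply: cvgB; [exact: depth_continuous|exact: cvg_cst].
  by apply: cvgD => //; exact: cvg_norm.
have nA : ~ A y.
  move=> /AC[U CU [e e0 eU]].
  have : Num.min e 1 <= depth C y.
    apply: (@depth_ge C U) => //; first by rewrite le_min (ltW e0) ler01/= ge_min lexx orbT.
    by move=> z; rewrite lt_min => /andP[? _]; exact: eU.
  by rewrite leNgt (le_lt_trans dC0)// lt_min e0 ltr01.
have dA0 : depth [set A] y <= 0 by rewrite leNgt; apply/negP => /depth_mem.
apply: cvg_near_cst.
have m0 : 0 < m.+1%:R^-1 :> R by rewrite invr_gt0 ltr0n.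
apply: filterS (dnbhs y m0) => z /= yz.
have := depth_lipschitz [set A] z y; rewrite (dC z y) => zy.
rewrite /depth_ratio; move: m0 yz; set u := m.+1%:R^-1 => m0 yz.
by rewrite !ler0_norm ?subrr ?mul0r//; lra.
Qed.
End depth.

(** Urysohn metrization: one continuous function for each pair of basic sets, the closure of one
    lying inside the other, suffices to separate points from closed sets. *)
Lemma regular_compatible_dist (R : realType) (Y : topologicalType) (I : countType)
    (W : I -> set Y) : indexed_basis W -> regular_space Y ->
  exists d : Y -> Y -> R,
    [/\ forall x, d x x = 0, forall x y, d x y = d y x,
        forall y x z, d x z <= d x y + d y z,
        forall x e, 0 < e -> nbhs x [set y | d x y < e] &
        forall x A, nbhs x A -> exists2 e, 0 < e & [set y | d x y < e] `<=` A].
Proof.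
move=> Wb reg; have [Wo _] := Wb; have /(@normal_separatorP R) nor := regular_normal R Wb reg.
pose sep i j := closure (W j) `<=` W i.
pose f (k : I * I) : Y -> R :=
  if `[< sep k.1 k.2 >] then Urysohn (~` W k.1) (closure (W k.2)) else fun=> 0.
have fc k : continuous (f k).
  rewrite /f; case: asboolP => // _; first exact: Urysohn_continuous.
  by move=> x; exact: cvg_cst.
exists (fdist f); split.
- exact: fdistxx.
- exact: fdistC.
- exact: fdist_triangle.
- by move=> x e; exact: fdist_nbhs.
move=> x A; rewrite nbhsE => -[O [Oo Ox] OA].
have [i Wix WiO] := Wb.2 x O Oo Ox.
have [j Wjx ji] := regular_open_basis Wb reg (Wo i) Wix.
have us : uniform_separator (~` W i) (closure (W j)).
  apply: nor; [exact: open_closedC|exact: closed_closure|].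
  by rewrite setIC; apply/disjoints_subset; rewrite setCK.
exists (2^-1 ^+ pickle (i, j)); first by rewrite exprn_gt0.
move=> y /= xy; apply/OA/WiO; apply: contrapT => Wiy.
have := fdist_lt xy (lexx _); rewrite /f /= asboolT//.
have -> : Urysohn (~` W i) (closure (W j)) y = 0 :> R.
  by apply: (Urysohn_sub0 us); exists y.
have -> : Urysohn (~` W i) (closure (W j)) x = 1 :> R.
  by apply: (Urysohn_sub1 us); exists x => //; exact: subset_closure.
rewrite subr0 normr1 ltNge exprn_ile1 ?invr_ge0//.
by rewrite invf_le1 ?ler1n.
Qed.

(* In a metric completion, the conditions "if [A c] is large then so is [W i]
   for some [i] in [C c]" cut out an intersection of countably many sets of the
   form closed or open, hence a G_delta; adding the functions [depth_ratio] to
   the distance makes that set complete. *)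
Lemma polish_of_conditions (R : realType) (Y : topologicalType) (I K : countType)
    (W : I -> set Y) (A : K -> set Y) (C : K -> set I) :
  indexed_basis W -> regular_space Y ->
  (forall x y : Y, (forall O, open O -> O x -> O y) -> x = y) ->
  (forall c, A c `<=` \bigcup_(i in C c) W i) ->
  (forall Phi : set_system Y, ProperFilter Phi ->
    (forall c, Phi (A c) -> exists2 i, C c i & Phi (W i)) ->
    exists x, forall i, Phi (W i) -> W i x) ->
  polish R Y.
Proof.
move=> Wb reg kol AC forced.
have [d0 [dxx dC dtri dn nd]] := regular_compatible_dist R Wb reg.
have d_ge0 x y : 0 <= d0 x y by have := dtri y x x; rewrite dxx (dC y x); lra.
(* The extra conditions [inr m] demand a basic set with all distances below [1/(m+1)]; a filter
   obeying them contains arbitrarily small sets. *)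
pose A' (c : K + nat) := if c is inl k then A k else setT.
pose C' (c : K + nat) := match c with
  | inl k => C k
  | inr m => [set i | forall y z, W i y -> W i z -> d0 y z < m.+1%:R^-1] end.
have AC' c : A' c `<=` \bigcup_(i in C' c) W i.
  case: c => [k|m]; first exact: AC.
  move=> x _; have m0 : 0 < m.+1%:R^-1 / 2 :> R by rewrite divr_gt0// invr_gt0 ltr0n.
  have [i Wix Wi] := Wb.2 x _ (open_interior _) (dn x _ m0).
  exists i => // y z /Wi/interior_subset/= xy /Wi/interior_subset/= xz.
  move: m0 xy xz; set u := m.+1%:R^-1 => m0 xy xz.
  by have := dtri x y z; rewrite (dC y x); lra.
pose g (cm : (K + nat) * nat) := depth_ratio d0 (A' cm.1) (W @` C' cm.1) cm.2.
have gc cm : continuous (g cm).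
  apply: depth_ratio_continuous => // x /AC'[i Ci Wix]; exists (W i); first by exists i.
  by apply: nd; apply: open_nbhs_nbhs; split=> //; exact: Wb.1.
(* Along a filter that is Cauchy for [d] each ratio stays bounded, so a positive lower bound for the
   depth in [A' c] forces one for the depth in the cover. *)
pose d x y := d0 x y + fdist g x y.
have dle x y : d0 x y <= d x y by rewrite lerDl fdist_ge0.
have gle x y : fdist g x y <= d x y by rewrite lerDr.
apply: (@polish_of_dist R Y d).
- exact: indexed_basis_second_countable Wb.
- by move=> x; rewrite /d dxx fdistxx addr0.
- move=> x y dxy; apply: kol => O Oo Ox.
  have [e e0 eO] := nd x O (open_nbhs_nbhs (conj Oo Ox)).
  by apply: eO; rewrite /=; have := dle x y; rewrite dxy; lra.
- by move=> x y; rewrite /d dC fdistC.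
- move=> y x z; rewrite /d; have := dtri y x z; have := fdist_triangle g y x z; lra.
- move=> x e e0; have e20 : 0 < e / 2 by rewrite divr_gt0.
  apply: filterS (filterI (dn x _ e20) (fdist_nbhs x gc e20)) => y /= [? ?].
  by rewrite /d; lra.
- move=> x B /nd[e e0 eB]; exists e => // y /= xy; apply: eB => /=.
  exact: le_lt_trans xy.
move=> F FF Fc.
have Fd e : 0 < e -> exists x, F [set y | d0 x y < e].
  move=> /Fc[x Fx]; exists x; apply: filterS Fx => y /=; exact: le_lt_trans.
(* [Phi] keeps the sets that contain a uniform neighborhood of a set of [F]; this margin turns into
   a lower bound on depth. *)
pose Phi (B : set Y) := exists2 e, 0 < e & F [set y | forall z, d0 y z < e -> B z].
have PhiF B : Phi B -> F B.
  by move=> [e e0]; apply: filterS => y /= yB; apply: yB; rewrite dxx.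
have PhiP : ProperFilter Phi.
  apply: Build_ProperFilter_ex; first by move=> B /PhiF/filter_ex.
  split.
  - by exists 1 => //; apply: filterS filterT.
  - move=> B B' [e e0 eB] [e' e'0 eB']; exists (Num.min e e'); first by rewrite lt_min e0.
    apply: filterS (filterI eB eB') => y /= [yB yB'] z; rewrite lt_min => /andP[ze ze'].
    by split; [exact: yB|exact: yB'].
  - move=> B B' BB' [e e0 eB]; exists e => //.
    by apply: filterS eB => y /= yB z /yB/BB'.
have PhiC c : Phi (A' c) -> exists2 i, C' c i & Phi (W i).
  move=> [e e0 Fe]; pose e1 := Num.min e 1.
  have e1p : 0 < e1 by rewrite lt_min e0 ltr01.
  have FA : F [set y | e1 <= depth d0 [set A' c] y].
    apply: filterS Fe => y /= ye; apply: (@depth_ge _ _ _ _ (A' c)) => //.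
      by rewrite ltW//= ge_min lexx orbT.
    by move=> z; rewrite lt_min => /andP[ze _]; exact: ye.
  have [m me] : exists m, (m.+1%:R^-1 : R) < e1 / 2.
    have e2p : 0 < e1 / 2 by rewrite divr_gt0.
    near \oo => m; exists m; near: m.
    exact: (near_infty_natSinv_lt (PosNum e2p)).
  (* The cap on the coordinate [(c, m)]: at distances below [p] the true difference of the ratios is
     seen, which bounds the ratio by [M] on a set of [F]. *)
  pose p := 2^-1 ^+ pickle (c, m) : R.
  have p0 : 0 < p by rewrite exprn_gt0.
  have [x Fx] := Fc p p0.
  pose M := `|g (c, m) x| + p.
  have M0 : 0 < M by rewrite ltr_wpDl.
  pose r := e1 / 2 / M.
  have r0 : 0 < r by rewrite !divr_gt0.
  have FH : F [set y | r < depth d0 (W @` C' c) y].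
    apply: filterS (filterI FA Fx) => y /= [Ay xy].
    have gM : g (c, m) y < M.
      have := fdist_lt (le_lt_trans (gle x y) xy) (lexx _).
      rewrite /M => gxy; have := ler_norm (g (c, m) y).
      have := ler_distD (g (c,m) x) (g (c, m) y) 0; rewrite !subr0 (distrC (g _ y)).
      lra.
    have H0 : 0 < depth d0 (W @` C' c) y.
      have [i Ci Wi] : exists2 i, C' c i & W i y.
        have /AC'[i Ci Wi] : A' c y; last by exists i.
        by apply: (depth_mem dxx); exact: lt_le_trans Ay.
      have [s s0 sW] : exists2 s, 0 < s & [set z | d0 y z < s] `<=` W i.
        by apply: nd; apply: open_nbhs_nbhs; split=> //; exact: Wb.1.
      apply: (@lt_le_trans _ _ (Num.min s 1)); first by rewrite lt_min s0 ltr01.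
      apply: (@depth_ge _ _ _ _ (W i)); [|by exists i|].
        by rewrite le_min ltW//= ler01 ge_min lexx orbT.
      by move=> z; rewrite lt_min => /andP[zs _]; exact: sW.
    rewrite /r ltr_pdivrMr// -ltr_pdivrMl// [X in X < _]mulrC; apply: le_lt_trans gM.
    rewrite /g /depth_ratio /= ler_pM2r ?invr_gt0//.
    move: me Ay; set u := _.+1%:R^-1; set v := depth _ _ _ => me Ay.
    by rewrite ger0_norm; lra.
  have r40 : 0 < r / 4 by rewrite divr_gt0.
  have [x1 Fx1] := Fd (r / 4) r40.
  have [y0 [/= ry0 xy0]] := filter_ex (filterI FH Fx1).
  have [_ [i Ci <-] iW] := depth_gt (ltW r0) ry0.
  (* Points of a ball of radius [r/4] are within [r/2] of [y0], which leaves a margin of [r/2]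
     inside [W i]. *)
  exists i => //; exists (r / 2); first by rewrite divr_gt0.
  apply: filterS Fx1 => y /= xy z yz; apply: iW.
  have := dtri x1 y0 z; have := dtri y x1 z; rewrite (dC y0 x1); lra.
have [x xW] := forced Phi PhiP (fun c => PhiC (inl c)).
exists x => O; move=> /nd[e e0 eO].
have [m me] : exists m, (m.+1%:R^-1 : R) < e.
  near \oo => m; exists m; near: m.
  exact: (near_infty_natSinv_lt (PosNum e0)).
have [i Ci PW] := PhiC (inr m) filterT.
apply: filterS (PhiF _ PW) => y Wiy; apply: eO => /=.
by apply: lt_trans me; apply: Ci => //; exact: xW.
Unshelve. all: by end_near.
Qed.

(** * Category in subspaces *)

Section relative_category.
Context (T : topologicalType).
Implicit Types S A O F : set T.

(** Category is expressed with open sets of the ambient space, so that fibers and their translates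
    can be handled without subtypes. *)
Definition nowhere_dense_in S F := forall O, open O -> O `&` S !=set0 ->
  exists O', [/\ open O', O' `<=` O, O' `&` S !=set0 & forall x, O' x -> S x -> ~ F x].

Definition meager_in S A := exists2 F : nat -> set T,
  forall n, nowhere_dense_in S (F n) & S `&` A `<=` \bigcup_n F n.

Lemma nowhere_dense_in0 S : nowhere_dense_in S set0.
Proof. by move=> O Oo OS; exists O; split=> // x _ _. Qed.

Lemma nowhere_dense_meager_in S A : nowhere_dense_in S A -> meager_in S A.
Proof. by exists (fun=> A) => // x [_ Ax]; exists 0%N. Qed.

Lemma meager_inS S A B : S `&` A `<=` B -> meager_in S B -> meager_in S A.
Proof.
move=> AB [F Fn BF]; exists F => // x [Sx Ax]; apply: BF; split=> //.
exact: AB.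
Qed.

Lemma meager_in_bigcup (I : countType) S (A : I -> set T) :
  (forall i, meager_in S (A i)) -> meager_in S (\bigcup_i A i).
Proof.
move=> mA; have /choice[F FP] : forall i, exists F : nat -> set T,
    (forall n, nowhere_dense_in S (F n)) /\ S `&` A i `<=` \bigcup_n F n.
  by move=> i; have [F] := mA i; exists F.
exists (fun k => if @unpickle (I * nat)%type k is Some (i, n) then F i n else set0).
  move=> k; case: unpickle => [[i n]|]; first exact: (FP i).1.
  exact: nowhere_dense_in0.
move=> x [Sx [i _ Aix]]; have [n _ Fx] := (FP i).2 x (conj Sx Aix).
by exists (pickle (i, n)); rewrite // pickleK.
Qed.

Lemma meager_in0 S A : S `&` A `<=` set0 -> meager_in S A.
Proof. by move=> A0; exists (fun=> set0) => // [n|x /A0//]; exact: nowhere_dense_in0. Qed.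

Lemma meager_inU S A B : meager_in S A -> meager_in S B -> meager_in S (A `|` B).
Proof.
move=> mA mB; apply: (@meager_inS _ _ (\bigcup_(b : bool) (if b then A else B))).
  by move=> x [_ [Ax|Bx]]; [exists true|exists false].
by apply: meager_in_bigcup => -[].
Qed.

Lemma not_meager_in_nonempty S A : ~ meager_in S A -> S `&` A !=set0.
Proof.
move=> nm; apply: contrapT => n0; apply/nm/meager_in0 => x SAx.
by apply: n0; exists x.
Qed.

Lemma meager_in_setI V S A : open V -> meager_in (V `&` S) A <-> meager_in S (V `&` A).
Proof.
move=> Vo; split=> -[F Fn AF].
  exists (fun n => V `&` F n); last first.
    by move=> x [Sx [Vx Ax]]; have [n _ Fx] := AF x (conj (conj Vx Sx) Ax); exists n.
  move=> n O Oo OS; have [OVS|n0] := pselect ((O `&` V) `&` (V `&` S) !=set0).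
    have [O' [O'o O'O [x [O'x [Vx Sx]]] O'F]] := Fn n _ (openI Oo Vo) OVS.
    exists O'; split=> //; [by move=> y /O'O[]|by exists x|].
    by move=> y O'y Sy [Vy Fy]; apply: (O'F y).
  exists O; split=> // x Ox Sx [Vx Fx].
  by apply: n0; exists x; split; split.
exists F => [n O Oo [x [Ox [Vx Sx]]]|x [[Vx Sx] Ax]]; last exact: AF.
have [|O' [O'o O'O [y [O'y Sy]] O'F]] := Fn n _ (openI Oo Vo); first by exists x.
have [Oy Vy] := O'O _ O'y.
exists O'; split=> //; [by move=> z /O'O[]|by exists y|].
by move=> z O'z [_ Sz]; exact: O'F.
Qed.

Lemma meager_meager_in S A : meager [set x : set_type S | A (val x)] <-> meager_in S A.
Proof.
split=> [[F Fn AF]|[F Fn AF]].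
  exists (fun n => val @` F n); last first.
    move=> x [Sx Ax]; have : [set x : set_type S | A (val x)] (exist _ x (mem_set Sx)) by [].
    by rewrite AF => -[n _ Fx]; exists n => //; exists (exist _ x (mem_set Sx)).
  move=> n O Oo [x [Ox Sx]].
  have [O1 nO1] : exists2 y : set_type S, O (val y) & ~ closure (F n) y.
    apply: contrapT => nO; have : interior (closure (F n)) (exist _ x (mem_set Sx)).
      apply: (@filterS _ _ _ (val @^-1` O)).
        by move=> y Oy; apply: contrapT => nc; apply: nO; exists y.
      by apply: open_nbhs_nbhs; split=> //; exists O.
    by rewrite (Fn n).
  move=> nc; have [B Bo BE] := closed_openC (@closed_closure _ (F n)).
  exists (O `&` B); split; [exact: openI|by move=> y []| |].
    exists (val O1); split; last exact: set_mem (valP O1).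
    split=> //; suff : (set_val @^-1` B) O1 by rewrite set_valE.
    by rewrite BE.
  move=> y [Oy By] Sy [z Fz zy].
  have : (~` closure (F n)) z by rewrite -BE /= set_valE/= zy.
  by apply; exact: subset_closure.
(* Intersecting with [A] turns the covering by the [F n] into the equality that [meager]
   requires. *)
exists (fun n => [set x | F n (val x) /\ A (val x)]).
  move=> n; rewrite /nowhere_dense -subset0 => x xi.
  have := @open_interior _ (closure [set x : set_type S | F n (val x) /\ A (val x)]).
  move=> [B Bo BE].
  have Bx : B (val x) by move: xi; rewrite -BE /= set_valE.
  have [|O' [O'o O'B [y [O'y Sy]] O'F]] := Fn n B Bo.
    by exists (val x); split=> //; exact: set_mem (valP x).
  pose y' : set_type S := exist _ y (mem_set Sy).
  have : closure [set x : set_type S | F n (val x) /\ A (val x)] y'.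
    by apply: interior_subset; rewrite -BE /= set_valE/=; exact: O'B.
  move=> /(_ (set_val @^-1` O'))[|z [[Fz _]]].
    by apply: open_nbhs_nbhs; split; [exists O'|rewrite /= set_valE].
  rewrite /= set_valE => /O'F; apply => //; exact: set_mem (valP z).
apply/seteqP; split=> [x Ax|x [n _ []]//].
have [|n _ Fx] := AF (val x); first by split=> //; exact: set_mem (valP x).
by exists n.
Qed.

(** Baire category: open sets that shrink along the sieve while step [n] avoids [F n] have a common
    point in [S], outside every [F n]. *)
Lemma sieve_complete_baire S O : sieve_complete S -> open O -> O `&` S !=set0 ->
  ~ meager_in S O.
Proof.
move=> [prec [precS precO precC]] Oo OS [F Fn OF].
pose rel n (A A' : set T) := prec n A' A /\ forall x, A' x -> S x -> ~ F n x.
have [|n A [Ao AS]|A [A0 AI AR]] :=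
  @dependent_sequence _ (fun A => open A /\ A `&` S !=set0) rel O; first by [].
  have [B [Bo BA [z [Bz Sz]] BF]] := Fn n A Ao AS.
  have [O' O'o [O'z O'p]] := precO n A z Ao (BA _ Bz) Sz.
  exists (O' `&` B); split; first by split; [exact: openI|by exists z].
  by split=> [|x [_ Bx]]; [apply: O'p => x []|exact: BF].
have [|n|z Sz [Az _]] := precC A; [by move=> n; have [] := AI n|by have [] := AR n|].
have [|n _ Fz] := OF z; first by split=> //; rewrite -A0; exact: Az.
by have [_ /(_ z (Az n.+1) Sz)] := AR n.
Qed.

Context (U : nat -> set T).
Hypothesis Ub : indexed_basis U.

(** The part of [A] inside those basic open sets on which [A] is meager is a countable union of
    meager sets, so some point of [A] in [S] is left over. *)
Lemma not_meager_in_point S A : ~ meager_in S A ->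
  exists g, [/\ S g, A g & forall O, open O -> O g -> ~ meager_in S (A `&` O)].
Proof.
move=> nmA; apply: contrapT => npt; apply: nmA.
pose M n := if pselect (meager_in S (A `&` U n)) then A `&` U n else set0.
apply: (@meager_inS _ _ (\bigcup_n M n)).
  move=> x [Sx Ax]; apply: contrapT => nx; apply: npt; exists x; split=> // O Oo Ox mO.
  have [i Uix UiO] := Ub.2 x O Oo Ox.
  apply: nx; exists i => //; rewrite /M; case: pselect => // -[].
  by apply: meager_inS mO => y [_ [Ay /UiO Oy]].
apply: meager_in_bigcup => n; rewrite /M; case: pselect => [//|nm] /=.
by apply: meager_in0 => x [].
Qed.

(** The Baire property in a local form that is visibly symmetric under complement. *)
Definition baire_in S A := forall O, open O -> O `&` S !=set0 ->
  exists O', [/\ open O', O' `<=` O, O' `&` S !=set0 &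
    meager_in S (O' `&` A) \/ meager_in S (O' `\` A)].

Lemma baire_inC S A : baire_in S A -> baire_in S (~` A).
Proof.
move=> bA O Oo OS; have [O' [O'o O'O O'S mO']] := bA O Oo OS.
by exists O'; split=> //; rewrite setDE setCK -setDE; case: mO'; [right|left].
Qed.

Lemma baire_in_open S A : (forall x, S x -> A x ->
  exists2 O, open O & O x /\ O `&` S `<=` A) -> baire_in S A.
Proof.
move=> Ao O Oo OS; have [[x [[Ox Sx] Ax]]|n0] := pselect ((O `&` S) `&` A !=set0).
  have [O' O'o [O'x O'A]] := Ao x Sx Ax.
  exists (O `&` O'); split; [exact: openI|by move=> y []|by exists x|].
  by right; apply: meager_in0 => y [Sy [[_ O'y] nAy]]; apply: nAy; exact: O'A.
exists O; split=> //; left; apply: meager_in0 => x [Sx [Ox Ax]].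
by apply: n0; exists x.
Qed.

(** Otherwise the basic sets on which [A] is meager are dense in [O]; [O] minus their union [D] is
    then nowhere dense, and [A] is meager in [O]. *)
Lemma baire_in_not_meager S A O : baire_in S A -> open O -> ~ meager_in S (O `&` A) ->
  exists i, [/\ U i `<=` O, U i `&` S !=set0 & meager_in S (U i `\` A)].
Proof.
move=> bA Oo nm; apply: contrapT => nU; apply: nm.
pose good n := U n `<=` O /\ meager_in S (U n `&` A).
pose M n := if pselect (good n) then U n `&` A else set0.
pose D := \bigcup_(n in good) U n.
apply: (@meager_inS _ _ ((O `\` D) `|` \bigcup_n M n)).
  move=> x [Sx [Ox Ax]]; have [[n gn Ux]|] := pselect (D x); last by left.
  by right; exists n => //; rewrite /M; case: pselect.
apply: meager_inU; last first.
  apply: meager_in_bigcup => n; rewrite /M; case: pselect => [[]//|ng] /=.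
  by apply: meager_in0 => x [].
apply: nowhere_dense_meager_in => O1 O1o O1S.
have [OS|n0] := pselect ((O1 `&` O) `&` S !=set0); last first.
  by exists O1; split=> // x O1x Sx [Ox _]; apply: n0; exists x.
have [O' [O'o O'O [x [O'x Sx]] O'm]] := bA _ (openI O1o Oo) OS.
have [i Uix UiO'] := Ub.2 x O' O'o O'x.
have gi : good i.
  split; first by move=> y /UiO'/O'O[].
  case: O'm => m; first by apply: meager_inS m => y [_ [/UiO']].
  case: nU; exists i; split; [by move=> y /UiO'/O'O[]|by exists x|].
  by apply: meager_inS m => y [_ [/UiO']].
exists (U i); split; [exact: Ub.1|by move=> y /UiO'/O'O[]|by exists x|].
by move=> y Uiy _ [_]; apply; exists i.
Qed.

Lemma baire_in_bigcup S (A : nat -> set T) : (forall n, baire_in S (A n)) ->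
  baire_in S (\bigcup_n A n).
Proof.
move=> bA O Oo OS; have [m|nm] := pselect (meager_in S (O `&` \bigcup_n A n)).
  by exists O; split=> //; left.
have [n nmn] : exists n, ~ meager_in S (O `&` A n).
  apply/existsNP => mn; apply: nm; apply: meager_inS (meager_in_bigcup mn).
  by move=> x [_ [Ox [n _ Ax]]]; exists n.
have [i [UiO UiS Uim]] := baire_in_not_meager (bA n) Oo nmn.
exists (U i); split=> //; first exact: Ub.1.
by right; apply: meager_inS Uim => x [_ [Ux nA]]; split=> // Ax; apply: nA; exists n.
Qed.

End relative_category.

(** * Vaught transforms *)

Lemma within_prodP (T1 T2 U : topologicalType) (D : set (T1 * T2)) (f : T1 * T2 -> U) :
  {within D, continuous f} <->
  forall a b, D (a, b) -> forall O, open O -> O (f (a, b)) ->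
    exists A B, [/\ open A, open B, A a, B b &
      forall a' b', A a' -> B b' -> D (a', b') -> O (f (a', b'))].
Proof.
split=> [/subspace_continuousP fc a b Dab O Oo Oab|fc].
  have [[A' B'] /= [nA' nB'] AB] := fc _ Dab O (open_nbhs_nbhs (conj Oo Oab)).
  exists (interior A'), (interior B'); split=> //; [exact: open_interior..|].
  move=> a' b' /interior_subset Aa' /interior_subset Bb'; exact: AB.
apply/subspace_continuousP => -[a b] Dab N; rewrite nbhsE => -[O [Oo Oab] ON].
have [A [B [Ao Bo Aa Bb AB]]] := fc a b Dab O Oo Oab.
exists (A, B) => /=; first by split; apply: open_nbhs_nbhs.
by move=> [a' b'] /= [Aa' Bb'] Dab'; apply/ON/AB.
Qed.

Lemma open_continuousP (T U : topologicalType) (f : T -> U) : continuous f <->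
  forall x O, open O -> O (f x) -> exists2 A, open A & A x /\ A `<=` f @^-1` O.
Proof.
split=> [fc x O Oo Ox|fc x N].
  exists (f @^-1` O); last by split.
  by apply: open_comp => // y _; exact: fc.
rewrite nbhsE => -[O [Oo Ox] ON]; have [A Ao [Ax AO]] := fc x O Oo Ox.
by rewrite nbhs_simpl/= nbhsE; exists A => // y /AO/ON.
Qed.

Lemma locally_polish_basis (R : realType) (T : topologicalType) : locally_polish R T ->
  exists2 U : nat -> set T, indexed_basis U & forall i, sieve_complete (U i).
Proof.
move=> [B Bc [Bb Bp]]; have [W Wb WB] := countable_basis_indexed Bc Bb.
exists W => // n; have [Bn|->] := WB n; first exact: sieve_complete_set (Bp _ Bn).
by exists (fun _ _ _ => False); split=> // A A0; have [x []//] := A0 0%N.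
Qed.

Section vaught_transform.
Context (R : realType) (G : topologicalType) (gd : groupoid G).
Context (hG : polish_groupoid R gd).
Context (X : topologicalType) (p : X -> G) (act : G -> X -> X).
Context (hX : polish_gspace R gd p act).

Local Notation s := (src gd).
Local Notation r := (rng gd).
Local Notation "g ** h" := (Defs.comp gd g h) (at level 40, left associativity).
Local Notation "g ^i" := (ginv gd g) (at level 3, format "g ^i").
Local Notation "g @@ x" := (act g x) (at level 38, right associativity).
Local Notation S z := (s @^-1` [set z]).

Lemma src_anchor x : s (p x) = p x.
Proof. exact: (gact_anchor_objects (pgsp_action hX)). Qed.

Lemma rng_anchor x : r (p x) = p x.
Proof. by rewrite -{1}src_anchor rng_src src_anchor. Qed.

Lemma compKV g h : s g = s h -> g ** h^i ** h = g.
Proof.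
by move=> gh; rewrite -Defs.compA ?src_ginv ?rng_ginv// comp_ginvl -gh comp_src.
Qed.

Lemma compK g h : s g = r h -> g ** h ** h^i = g.
Proof.
by move=> gh; rewrite -Defs.compA ?src_ginv ?rng_ginv// comp_ginvr -gh comp_src.
Qed.

Lemma actK g x : s g = p x -> g^i @@ g @@ x = x.
Proof.
move=> gx; rewrite (gact_comp (pgsp_action hX)) ?src_ginv// comp_ginvl gx.
exact: (gact_id (pgsp_action hX)).
Qed.

Lemma actKV g x : r g = p x -> g @@ g^i @@ x = x.
Proof.
move=> gx; rewrite (gact_comp (pgsp_action hX)) ?src_ginv ?rng_ginv// comp_ginvr gx.
exact: (gact_id (pgsp_action hX)).
Qed.

Lemma anchor_act g x : s g = p x -> p (g @@ x) = r g.
Proof. exact: (gact_anchor (pgsp_action hX)). Qed.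

Lemma comp_nbhs g h O : s g = r h -> open O -> O (g ** h) -> exists A B,
  [/\ open A, open B, A g, B h &
    forall g' h', A g' -> B h' -> s g' = r h' -> O (g' ** h')].
Proof.
move=> gh Oo Ogh; have /within_prodP := pgpd_comp_continuous hG.
by move=> /(_ g h gh O Oo Ogh).
Qed.

Lemma ginv_nbhs g O : open O -> O g^i ->
  exists2 A, open A & A g /\ forall g', A g' -> O g'^i.
Proof. by move/open_continuousP: (pgpd_inv_continuous hG); exact. Qed.

Lemma compV_nbhs g h O : s g = s h -> open O -> O (g ** h^i) -> exists A B,
  [/\ open A, open B, A g, B h &
    forall g' h', A g' -> B h' -> s g' = s h' -> O (g' ** h'^i)].
Proof.
move=> gh Oo Ogh; have [|A [B [Ao Bo Ag Bh AB]]] := comp_nbhs _ Oo Ogh.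
  by rewrite rng_ginv.
have [B' B'o [B'h B'B]] := ginv_nbhs Bo Bh.
exists A, B'; split=> // g' h' Ag' /B'B Bh' gh'.
by apply: AB => //; rewrite rng_ginv.
Qed.

Lemma act_nbhs g x O : s g = p x -> open O -> O (g @@ x) -> exists A B,
  [/\ open A, open B, A g, B x &
    forall g' x', A g' -> B x' -> s g' = p x' -> O (g' @@ x')].
Proof.
move=> gx Oo Ogx; have /within_prodP := cact_act (pgsp_continuous hX).
by move=> /(_ g x gx O Oo Ogx).
Qed.

Lemma actV_nbhs g x O : r g = p x -> open O -> O (g^i @@ x) -> exists A B,
  [/\ open A, open B, A g, B x &
    forall g' x', A g' -> B x' -> r g' = p x' -> O (g'^i @@ x')].
Proof.
move=> gx Oo Ogx; have [|A [B [Ao Bo Ag Bx AB]]] := act_nbhs _ Oo Ogx.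
  by rewrite src_ginv.
have [A' A'o [A'g A'A]] := ginv_nbhs Ao Ag.
exists A', B; split=> // g' x' /A'A Ag' Bx' gx'.
by apply: AB => //; rewrite src_ginv.
Qed.

Lemma anchor_nbhs x O : open O -> O (p x) -> exists2 A, open A & A x /\ A `<=` p @^-1` O.
Proof. by move/open_continuousP: (cact_anchor (pgsp_continuous hX)); exact. Qed.

Lemma rng_continuous : continuous r.
Proof.
apply/open_continuousP => g O Oo; rewrite -comp_ginvr => Og.
have [|A [B [Ao Bo Ag Bg AB]]] := comp_nbhs _ Oo Og; first by rewrite rng_ginv.
have [B' B'o [B'g B'B]] := ginv_nbhs Bo Bg.
exists (A `&` B'); first exact: openI.
split=> // h [Ah /B'B Bh] /=; rewrite -comp_ginvr; apply: AB => //.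
by rewrite rng_ginv.
Qed.

(** The source of [g] is the product of its inverse with [g]. The products of inverses of arrows of
    [O] with arrows of [O] form an open set, and an identity [z] in it is the source of its second
    factor. *)
Lemma src_open g O : open O -> O g ->
  exists2 N, open N & N (s g) /\ forall z, N z -> s z = z -> exists2 g', O g' & s g' = z.
Proof.
move=> Oo Og; pose W := (ginv gd @` O) `*` O.
have Wo : open W.
  rewrite openE => -[a b] /= [Va Ob]; exists (ginv gd @` O, O) => //=.
  by split; apply: open_nbhs_nbhs; split=> //; exact: (pgpd_inv_open hG).
exists ((fun gh => gh.1 ** gh.2) @` (W `&` composable gd)).
  exact: (pgpd_comp_open hG).
split.
  exists (g^i, g) => /=; last by rewrite comp_ginvl.
  by split=> /=; [split=> //; exists g|rewrite /composable/= src_ginv].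
move=> z [[a g'] /= [[_ Og']]]; rewrite /composable /= => ag' zE zz.
by exists g' => //; rewrite -(src_comp ag') zE zz.
Qed.

Lemma src_sieve_complete x : sieve_complete (S (p x)).
Proof.
exact: sieve_complete_set (pgpd_src_polish hG (src_anchor x)).
Qed.

(** Right translation by [g] is a homeomorphism from the source fiber over [r g] onto the one over
    [s g]; nowhere dense sets are transported by continuity in both directions. *)
Lemma meager_in_translate g (M : set G) :
  meager_in (S (s g)) M -> meager_in (S (r g)) [set h | M (h ** g)].
Proof.
move=> [F Fn MF]; exists (fun n => [set h | F n (h ** g)]); last first.
  move=> h [/= hg Mh]; have [|n _ Fh] := MF (h ** g); last by exists n.
  by split=> //=; rewrite src_comp.
move=> n O Oo [h0 [Oh0 /= h0g]].
have [||A [B [Ao Bo Ah Bg AB]]] := @compV_nbhs (h0 ** g) g O _ Oo.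
- by rewrite src_comp.
- by rewrite compK.
have [|O2 [O2o O2A [k1 [O2k1 /= k1g]] O2F]] := Fn n A Ao.
  by exists (h0 ** g); split=> //=; rewrite src_comp.
have [||A' [B' [A'o B'o A'h B'g AB']]] := @comp_nbhs (k1 ** g^i) g O2 _ O2o.
- by rewrite src_comp ?rng_ginv// src_ginv.
- by rewrite compKV.
exists (O `&` A'); split; [exact: openI|by move=> ? []| |].
  exists (k1 ** g^i); split; last by rewrite /= src_comp ?rng_ginv// src_ginv.
  by split=> //; apply: AB => //; exact: O2A.
move=> h [Oh A'h'] /= hg; apply: O2F; first exact: AB'.
by rewrite /= src_comp.
Qed.

(* [vaught] with the meagerness computed in the whole source fiber. *)
Definition vt (A : set X) (U : set G) : set X :=
  [set x | ~ meager_in (S (p x)) [set g | U g /\ A (g @@ x)]].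

Lemma vaughtE A U : open U -> vaught gd p act A U = vt A U.
Proof.
move=> Uo; apply/funext => x; apply/propext; rewrite /vaught /vt /=.
have E := meager_meager_in (fiber gd p U x) [set g | A (g @@ x)].
have E' := @meager_in_setI G U (S (p x)) [set g | A (g @@ x)] Uo.
split=> [[_ nm] m|nm]; first by apply/nm/E/E'.
split; last by move=> /E/E'.
by have [g [/= gx [Ug _]]] := not_meager_in_nonempty nm; exists g.
Qed.

Lemma vtS A A' U U' : U `<=` U' -> A `<=` A' -> vt A U `<=` vt A' U'.
Proof.
move=> UU AA x nm m; apply: nm; apply: meager_inS m => g [_ [/UU Ug /AA Ag]].
by split.
Qed.

Lemma vt_nonempty A U x : vt A U x -> exists g, [/\ U g, s g = p x & A (g @@ x)].
Proof. by move=> /not_meager_in_nonempty[g [/= gx [Ug Ag]]]; exists g. Qed.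

Lemma vt_bigcup (I : countType) (A : I -> set X) U x :
  vt (\bigcup_i A i) U x -> exists i, vt (A i) U x.
Proof.
move=> nm; apply/existsNP => mA; apply: nm.
apply: meager_inS (meager_in_bigcup mA) => g [_ [Ug [i _ Ag]]].
by exists i.
Qed.

Lemma vt_all A U x : open U -> U (p x) ->
  (forall g, U g -> s g = p x -> A (g @@ x)) -> vt A U x.
Proof.
move=> Uo Ux UA m; apply: (sieve_complete_baire (src_sieve_complete x) Uo).
  by exists (p x); split=> //=; exact: src_anchor.
by apply: meager_inS m => g [/= gx Ug]; split=> //; exact: UA.
Qed.

Lemma vt_open_set A U g x : open A -> open U -> U g -> s g = p x -> A (g @@ x) -> vt A U x.
Proof.
move=> Ao Uo Ug gx Ag m; have [B [C [Bo Co Bg Cx BC]]] := act_nbhs gx Ao Ag.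
apply: (sieve_complete_baire (src_sieve_complete x) (openI Uo Bo)).
  by exists g.
by apply: meager_inS m => h [/= hx [Uh Bh]]; split=> //; exact: BC.
Qed.

(** The substitution [k = h ** g] moves the category statement from the fiber over [r g] to the
    fiber over [p x]. *)
Lemma vt_act A U g x : s g = p x -> vt A U (g @@ x) ->
  ~ meager_in (S (p x)) [set k | U (k ** g^i) /\ A (k @@ x)].
Proof.
move=> gx nm; rewrite -gx => /meager_in_translate m; apply: nm.
rewrite anchor_act//; apply: meager_inS m => h [/= hg [Uh Ah]].
rewrite compK//; split=> //.
by rewrite -(gact_comp (pgsp_action hX)).
Qed.

Lemma act_vt A U g x (W : set G) : s g = p x ->
  ~ meager_in (S (p x)) [set k | W k /\ A (k @@ x)] ->
  (forall k, s k = p x -> W k -> U (k ** g^i)) -> vt A U (g @@ x).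
Proof.
move=> gx nm WU; rewrite /vt /= anchor_act// -src_ginv => /meager_in_translate.
rewrite rng_ginv gx => m; apply: nm; apply: meager_inS m => k [/= kx [Wk Ak]].
split; first exact: WU.
have kg : s k = s g by rewrite gx.
rewrite (gact_comp (pgsp_action hX)) ?src_comp ?src_ginv ?rng_ginv//.
by rewrite compKV.
Qed.

Context (U : nat -> set G).
Hypothesis Ub : indexed_basis U.

Lemma vt_point A V x : vt A V x -> exists g, [/\ s g = p x, V g, A (g @@ x) &
  forall O, open O -> O g -> vt A (V `&` O) x].
Proof.
move=> /(not_meager_in_point Ub)[g [/= gx [Vg Ag] gO]]; exists g; split=> // O Oo Og m.
by apply: (gO O Oo Og); apply: meager_inS m => h [_ [[Vh Ah] Oh]].
Qed.

(** This is the source of continuity of the action. The transform at [g x] concentrates near some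
    arrow [h0]; for [k] in a small basic set around [h0 ** g] and [h] near [g], the arrow [k ** h^i]
    is in [V]. *)
Lemma vt_act_nbhs A V g x : open V -> s g = p x -> vt A V (g @@ x) ->
  exists i N, [/\ open N, N g, vt A (U i) x &
    forall h y, N h -> s h = p y -> vt A (U i) y -> vt A V (h @@ y)].
Proof.
move=> Vo gx /vt_point[h0 [h0g Vh0 Ah0 h0O]]; rewrite anchor_act// in h0g.
have [||A' [N [A'o No A'k Ng AN]]] := @compV_nbhs (h0 ** g) g V _ Vo.
- by rewrite src_comp.
- by rewrite compK.
have [i Uik UiA] := Ub.2 _ _ A'o A'k.
exists i, N; split=> //; last first.
  move=> h y Nh hy m; apply: act_vt m _ => // k ky Uk.
  by apply: AN => //; [exact: UiA|rewrite ky].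
have [||B [C [Bo Co Bh0 Cg BC]]] := @comp_nbhs h0 g (U i) _ (Ub.1 i) => //.
move=> m; apply: (vt_act gx (h0O B Bo Bh0)); apply: meager_inS m.
move=> k [/= kx [[Vk Bk] Ak]]; split=> //.
have kg : s k = s g by rewrite gx.
by rewrite -(compKV kg); apply: BC => //; rewrite src_comp ?rng_ginv// src_ginv.
Qed.

(** Dual to the previous lemma: around a concentration point [k0], the set [V] contains the products
    of a basic set around [k0 ** g^i] with a neighborhood of [g]. *)
Lemma vt_factor A V g x : open V -> s g = p x -> vt A V x ->
  exists i N, [/\ open N, N g, vt A (U i) (g @@ x) &
    forall k h, U i k -> N h -> s k = r h -> V (k ** h)].
Proof.
move=> Vo gx /vt_point[k0 [k0x Vk0 Ak0 k0O]].
have k0g : s k0 = s g by rewrite gx.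
have [||A' [N [A'o No A'k Ng AN]]] := @comp_nbhs (k0 ** g^i) g V _ Vo.
- by rewrite src_comp ?rng_ginv// src_ginv.
- by rewrite compKV.
have [i Uik UiA] := Ub.2 _ _ A'o A'k.
exists i, N; split=> //; last by move=> k h /UiA Ak; exact: AN.
have [||B [C [Bo Co Bk0 Cg BC]]] := @compV_nbhs k0 g (U i) _ (Ub.1 i) => //.
apply: act_vt (k0O B Bo Bk0) _ => // k kx [Vk Bk].
by apply: BC => //; rewrite kx.
Qed.

(** Goes back from a factorization as in [vt_factor] to the original transform. *)
Lemma vt_factor_act A V W h y : s h = p y -> vt A W (h @@ y) ->
  (forall k, W k -> s k = r h -> V (k ** h)) -> vt A V y.
Proof.
move=> hy /(vt_act hy) nm WV m; apply: nm; apply: meager_inS m => k [/= ky [Wk Ak]].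
split=> //; have kh : s k = s h by rewrite hy.
by rewrite -(compKV kh); apply: WV => //; rewrite src_comp ?rng_ginv// src_ginv.
Qed.

End vaught_transform.

(** * Borel classes *)

Section borel_classes.
Context (T : topologicalType).
Implicit Types (A B : set T) (a b : omega1).

Lemma Sigma0_ge1 a A : Sigma0 a A -> om_le om_one a.
Proof.
case=> [{}a {}A _ a1 _|{}a b F /(_ 0%N)[b1 ba] _] //.
exact: om_le_trans b1 (om_le_trans (om_le_succ _) ba).
Qed.

Lemma Sigma0_inv a A : om_lt om_one a -> Sigma0 a A ->
  exists (b : nat -> omega1) (F : nat -> set T),
  [/\ forall n, om_le om_one (b n) /\ om_lt (b n) a,
      forall n, Sigma0 (b n) (~` F n) & A = \bigcup_n F n].
Proof.
move=> + aA; case: aA => [{}a {}A a1 _ _ lt1a|{}a b F ba bF _]; last by exists b, F.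
by case: (om_lt_irrefl (om_le_trans lt1a a1)).
Qed.

Lemma Sigma0_le1 a A : om_le a om_one -> Sigma0 a A -> open A.
Proof.
move=> + aA; case: aA => [//|{}a b F ba _ a1].
have [b1 lt_ba] := ba 0%N.
by case: (om_lt_irrefl (om_le_trans lt_ba (om_le_trans a1 b1))).
Qed.

Lemma Sigma0C a A : Sigma0 a A -> Sigma0 (om_succ a) (~` A).
Proof.
move=> aA; have -> : ~` A = \bigcup_(n : nat) ~` A.
  by apply/seteqP; split=> [x Ax|x [_ _]//]; exists 0%N.
apply: (@Sigma0_bigcup _ _ (fun=> a)) => n; last by rewrite setCK.
by split; [exact: Sigma0_ge1 aA|exact: om_le_refl].
Qed.

Context (W : nat -> set T).
Context (Wb : indexed_basis W) (Treg : regular_space T).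

Lemma open_bigcup_closed A : open A ->
  exists2 F : nat -> set T, forall n, closed (F n) & A = \bigcup_n F n.
Proof.
move=> Ao; exists (fun n => if `[< closure (W n) `<=` A >] then closure (W n) else set0).
  by move=> n; case: asboolP => _; [exact: closed_closure|exact: closed0].
apply/seteqP; split=> [x Ax|x [n _]]; last by case: asboolP => // nA /nA.
have [n Wx WA] := regular_open_basis Wb Treg Ao Ax.
by exists n => //; rewrite asboolT//; exact: subset_closure.
Qed.

Lemma open_Sigma0 a A : om_le om_one a -> open A -> Sigma0 a A.
Proof.
move=> a1 Ao; have [la|lt1a] := om_le_total a om_one; first exact: Sigma0_open.
have [F Fc ->] := open_bigcup_closed Ao.
apply: (@Sigma0_bigcup _ _ (fun=> om_one)) => n.
  by split=> //; exact: om_le_refl.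
by apply: Sigma0_open; [exact: om_le_refl..|exact: closed_openC].
Qed.

Lemma Sigma0_le a b A : om_le a b -> Sigma0 a A -> Sigma0 b A.
Proof.
move=> + aA; case: aA => [{}a {}A _ a1 Ao ab|{}a c F ca cF ab].
  by apply: open_Sigma0 => //; exact: om_le_trans ab.
apply: (@Sigma0_bigcup _ _ c) => // n; have [c1 lt_ca] := ca n.
by split=> //; exact: om_le_trans ab.
Qed.

Lemma Sigma0_union a (I : countType) (A : I -> set T) : om_le om_one a ->
  (forall i, Sigma0 a (A i)) -> Sigma0 a (\bigcup_i A i).
Proof.
move=> a1 aA; have [la|lt1a] := om_le_total a om_one.
  apply: Sigma0_open => //; apply: bigcup_open => i _; exact: Sigma0_le1 (aA i).
have /choice[F FP] : forall i, exists F : nat -> set T,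
    A i = \bigcup_n F n /\
    forall n, exists b, (om_le om_one b /\ om_lt b a) /\ Sigma0 b (~` F n).
  move=> i; have [b [F [ba bF AE]]] := Sigma0_inv lt1a (aA i).
  by exists F; split=> // n; exists (b n).
pose F' k := if @unpickle (I * nat)%type k is Some (i, n) then F i n else set0.
have -> : \bigcup_i A i = \bigcup_k F' k.
  apply/seteqP; split=> [x [i _]|x [k _]].
    by rewrite (FP i).1 => -[n _ Fx]; exists (pickle (i, n)); rewrite // /F' pickleK.
  rewrite /F'; case: unpickle => [[i n] Fx|//]; exists i => //.
  by rewrite (FP i).1; exists n.
have /choice[b bP] : forall k, exists b, (om_le om_one b /\ om_lt b a) /\ Sigma0 b (~` F' k).
  move=> k; rewrite /F'; case: unpickle => [[i n]|]; first exact: (FP i).2.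
  exists om_one; split; first by split; [exact: om_le_refl|].
  by rewrite setC0; apply: open_Sigma0; [exact: om_le_refl|exact: openT].
by apply: (@Sigma0_bigcup _ _ b) => k; [exact: (bP k).1|exact: (bP k).2].
Qed.

Lemma Sigma0U a A B : Sigma0 a A -> Sigma0 a B -> Sigma0 a (A `|` B).
Proof.
move=> aA aB; have -> : A `|` B = \bigcup_(c : bool) (if c then A else B).
  by apply/seteqP; split=> [x [|]|x [[]]]; [exists true|exists false|left|right].
apply: Sigma0_union; first exact: Sigma0_ge1 aA.
by case.
Qed.

Lemma om_le_addn a m n : (m <= n)%N -> om_le (om_addn a m) (om_addn a n).
Proof.
elim: n => [|n IH]; first by rewrite leqn0 => /eqP ->; exact: om_le_refl.
rewrite leq_eqVlt => /orP[/eqP->|]; first exact: om_le_refl.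
by rewrite ltnS => /IH h; apply: om_le_trans h (om_le_succ _).
Qed.

(** The level is not sharp: finite increments are harmless, so the intersection is obtained from
    complements and a union. *)
Lemma Sigma0I a m n A B : Sigma0 (om_addn a m) A -> Sigma0 (om_addn a n) B ->
  Sigma0 (om_addn a (maxn m n).+2) (A `&` B).
Proof.
move=> aA aB; rewrite -[A `&` B]setCK setCI; apply: Sigma0C; apply: Sigma0U; apply: Sigma0C.
  by apply: Sigma0_le aA; apply: om_le_addn; exact: leq_maxl.
by apply: Sigma0_le aB; apply: om_le_addn; exact: leq_maxr.
Qed.

(* One step down the Borel hierarchy. Quantifying over all ranks [a] of [B]
   lets a single [E] serve in inductions on the rank. *)
Definition resolution (B : set T) (E : nat -> set T) :=
  [/\ B = \bigcup_k E k,
      open B -> forall k, open (E k) /\ closure (E k) `<=` B &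
      ~ open B -> forall a, Sigma0 a B -> forall k,
        exists2 b, om_lt b a & Sigma0 b (~` E k)].

Lemma exists_resolution a B : Sigma0 a B -> exists E, resolution B E.
Proof.
move=> aB; have [Bo|nBo] := pselect (open B).
  exists (fun k => if `[< closure (W k) `<=` B >] then W k else set0); split=> //.
    apply/seteqP; split=> [x Bx|x [k _]].
      have [k Wx WB] := regular_open_basis Wb Treg Bo Bx.
      by exists k => //; rewrite asboolT.
    by case: asboolP => // WB Wx; apply: WB; exact: subset_closure.
  move=> _ k; case: asboolP => [WB|_]; first by split=> //; exact: Wb.1.
  by split; [exact: open0|rewrite closure0].
(* One decomposition has to serve all ranks of [B], so it is taken at the least rank, given by
   well-foundedness and totality of the order. *)
have [c [cB cmin]] : exists c, Sigma0 c B /\ forall a', Sigma0 a' B -> om_le c a'.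
  apply: contrapT => nc; elim/(well_founded_ind om_lt_wf): a aB => a IH aB.
  apply: nc; exists a; split=> // a' a'B.
  by have [//|/IH/(_ a'B)] := om_le_total a a'.
case: cB nBo cmin => {aB} [c' {}B _ _ Bo nBo|c' b F bc bF nBo cmin]; first by [].
exists F; split=> // _ a' a'B k; exists (b k); last exact: bF.
exact: om_le_trans (bc k).2 (cmin _ a'B).
Qed.

End borel_classes.

(** * Vaught transforms of Borel sets *)

Section vaught_borel.
Context (R : realType) (G : topologicalType) (gd : groupoid G).
Context (hG : polish_groupoid R gd).
Context (X : topologicalType) (p : X -> G) (act : G -> X -> X).
Context (hX : polish_gspace R gd p act).
Context (U : nat -> set G) (Ub : indexed_basis U).
Context (O : nat -> set X) (Ob : indexed_basis O).

Local Notation vt := (vt gd p act).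

Let Xreg : regular_space X := polish_regular (pgsp_polish hX).

(** Openness of the source map supplies, over every nearby point, an arrow of [V] close to [g]. *)
Lemma vt_open A V : open A -> open V -> open (vt A V).
Proof.
move=> Ao Vo; rewrite openE => x /vt_nonempty[g [Vg gx Ag]].
have [B [C [Bo Co Bg Cx BC]]] := act_nbhs hX gx Ao Ag.
have [N No [Nx NV]] := src_open hG (openI Vo Bo) (conj Vg Bg).
rewrite gx in Nx; have [A' A'o [A'x A'N]] := anchor_nbhs hX No Nx.
apply: (@filterS _ _ _ (C `&` A')); last first.
  by apply: open_nbhs_nbhs; split; [exact: openI|].
move=> y [Cy /A'N Ny]; have [h [Vh Bh] hy] := NV _ Ny (src_anchor hX y).
exact: (vt_open_set hG hX Ao Vo Vh hy (BC _ _ Bh Cy hy)).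
Qed.

Lemma Sigma0_baire a A x : Sigma0 a A ->
  baire_in (src gd @^-1` [set p x]) [set g | A (act g x)].
Proof.
elim=> {a A} [a A _ _ Ao|a b F _ _ IH].
  apply: baire_in_open => g /= gx Ag.
  have [B [C [Bo Co Bg Cx BC]]] := act_nbhs hX gx Ao Ag.
  by exists B => //; split=> // h [Bh /= hx]; exact: BC.
have -> : [set g | (\bigcup_n F n) (act g x)] = \bigcup_n [set g | F n (act g x)].
  by apply/seteqP; split=> g [n _ Fg]; exists n.
apply: (baire_in_bigcup Ub) => n.
have -> : [set g | F n (act g x)] = ~` [set g | (~` F n) (act g x)].
  by apply/seteqP; split=> g /=; [move=> ? []|move/contrapT].
exact: baire_inC.
Qed.

(** By the Baire property a nonmeager complement is comeager in some basic [U j]. The clause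
    [vt setT (U j) x] says that the fiber of [U j] is nonmeager, so that [A] and its complement
    cannot both be meager there. *)
Lemma vtC_bigcup a A i x : Sigma0 a A -> vt (~` A) (U i) x <->
  exists2 j, U j `<=` U i & ~ vt A (U j) x /\ vt setT (U j) x.
Proof.
move=> /(@Sigma0_baire _ _ x) bA; split=> [m|[j Uji [nm mT]]].
  have [j [Uji [g [Ujg /= gx]] mj]] := baire_in_not_meager Ub (baire_inC bA) (Ub.1 i) m.
  exists j => //; split.
    by apply => /=; apply: meager_inS mj => h [_ [Ujh Ah]]; split=> // /=; apply.
  exact: (vt_open_set hG hX openT (Ub.1 j) Ujg gx).
move=> m; apply: mT; move: nm => /contrapT nm.
apply: meager_inS (meager_inU m nm) => g [_ [Ujg _]].
have [Ag|nAg] := pselect (A (act g x)); [by right|left].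
by split=> //; exact: Uji.
Qed.

(** For a union, each [F n] is the complement of a set of lower class, so [vtC_bigcup] splits its
    transform into differences of an open set and a transform of lower class. Writing the open set
    as a union of closed [K j m] makes the complement of each piece a set of class [b n]. *)
Lemma Sigma0_vt a A i : Sigma0 a A -> Sigma0 a (vt A (U i)).
Proof.
move=> aA; elim: aA i => {a A} [a A a1 a1' Ao|a b F ba bF IH] i.
  by apply: Sigma0_open => //; apply: vt_open => //; exact: Ub.1.
have /choice[K KP] : forall j, exists K : nat -> set X,
    (forall n, closed (K n)) /\ vt setT (U j) = \bigcup_n K n.
  move=> j; have [|K] := @open_bigcup_closed _ _ Ob Xreg (vt setT (U j)).
    by apply: vt_open; [exact: openT|exact: Ub.1].
  by exists K.
pose H k := if @unpickle (nat * nat * nat)%type k is Some (n, j, m) then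
  if `[< U j `<=` U i >] then ~` (vt (~` F n) (U j)) `&` K j m else set0 else set0.
have -> : vt (\bigcup_n F n) (U i) = \bigcup_k H k.
  apply/seteqP; split=> [x /vt_bigcup[n]|x [k _]].
    rewrite -{1}(setCK (F n)) => /(vtC_bigcup _ _ (bF n))[j Uji [nx]].
    rewrite (KP j).2 => -[m _ Kx]; exists (pickle (n, j, m)) => //.
    by rewrite /H pickleK asboolT.
  rewrite /H; case: unpickle => [[[n j] m]|//]; case: asboolP => // Uji [nx Kx].
  apply: (@vtS _ _ _ _ _ (F n) _ (U i)) => //; first by move=> y Fy; exists n.
  rewrite -(setCK (F n)); apply/(vtC_bigcup _ _ (bF n)); exists j => //.
  by split=> //; rewrite (KP j).2; exists m.
(* Invalid codes give empty pieces, for which any admissible rank will do. *)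
pose b' k := if @unpickle (nat * nat * nat)%type k is Some (n, j, m) then b n else b 0%N.
apply: (@Sigma0_bigcup _ _ b') => k; rewrite /b' /H; case: unpickle => [[[n j] m]|] //.
  case: asboolP => Uji.
    rewrite setCI setCK; apply: (Sigma0U Ob Xreg); first exact: IH.
    apply: (open_Sigma0 Ob Xreg); first exact: (ba n).1.
    exact/closed_openC/(KP j).1.
  rewrite setC0; apply: (open_Sigma0 Ob Xreg); [exact: (ba n).1|exact: openT].
rewrite setC0; apply: (open_Sigma0 Ob Xreg); [exact: (ba 0%N).1|exact: openT].
Qed.

End vaught_borel.

(** * The refined topology *)

Section countable_closure.
Context (T : Type) (J : countType) (s : nat -> T) (f : J -> T -> T) (h : T -> T -> T).

(** Terms are labeled trees because these form a countable type. The label of a unary node codes the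
    operation; malformed nodes take values that stay in the closure. *)
Fixpoint closure_term (t : GenTree.tree nat) : T :=
  match t with
  | GenTree.Leaf n => s n
  | GenTree.Node n [:: t1] =>
      if unpickle n is Some j then f j (closure_term t1) else closure_term t1
  | GenTree.Node _ (t1 :: t2 :: _) => h (closure_term t1) (closure_term t2)
  | GenTree.Node _ [::] => s 0
  end.

Lemma closure_term_ind (P : T -> Prop) : (forall n, P (s n)) ->
  (forall j x, P x -> P (f j x)) -> (forall x y, P x -> P y -> P (h x y)) ->
  forall t, P (closure_term t).
Proof.
move=> Ps Pf Ph; fix IH 1; case=> [n|n [|t1 [|t2 ts]]] /=; [exact: Ps|exact: Ps| |].
  by case: unpickle => [j|]; [apply: Pf|]; exact: IH.
by apply: Ph; exact: IH.
Qed.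

Lemma closure_term_f j t : exists t', closure_term t' = f j (closure_term t).
Proof. by exists (GenTree.Node (pickle j) [:: t]); rewrite /= pickleK. Qed.

Lemma closure_term_h t1 t2 :
  exists t', closure_term t' = h (closure_term t1) (closure_term t2).
Proof. by exists (GenTree.Node 0 [:: t1; t2]). Qed.

End countable_closure.

Lemma topology_of_basis (T : topologicalType) (J : Type) (W : J -> set T) :
  (forall x, exists j, W j x) ->
  (forall j k x, W j x -> W k x -> exists2 l, W l x & W l `<=` W j `&` W k) ->
  exists t : Topological T, @indexed_basis (Topological.Pack t) J W.
Proof.
move=> Wx WI; pose op (A : set T) := forall x, A x -> exists2 j, W j x & W j `<=` A.
have opT : op setT by move=> x _; have [j Wj] := Wx x; exists j.
have opI : setI_closed op.
  move=> A B Ao Bo x [/Ao[j Wj jA] /Bo[k Wk kB]].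
  have [l Wl lI] := WI j k x Wj Wk.
  by exists l => // y /lI[/jA ? /kB].
have opU (I : Type) (f : I -> set T) : (forall i, op (f i)) -> op (\bigcup_i f i).
  move=> fo x [i _ /fo[j Wj jf]]; exists j => // y /jf fy; by exists i.
pose mt := isOpenTopological.Build T opT opI opU.
pose M : topologicalType := HB.pack (T : Type) (Choice.on T) mt.
have oE : @open M = op by [].
exists (Topological.class M); split=> [j|x A Ao].
  by suff : op (W j) by []; move=> x Wj; exists j.
by have : op A by []; exact.
Qed.

Section refined_topology.
Context (R : realType) (G : topologicalType) (gd : groupoid G).
Context (hG : polish_groupoid R gd).
Context (X : topologicalType) (p : X -> G) (act : G -> X -> X).
Context (hX : polish_gspace R gd p act).
Context (U : nat -> set G) (Ub : indexed_basis U) (Uc : forall n, sieve_complete (U n)).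
Context (O : nat -> set X) (Ob : indexed_basis O) (OT : O 0%N = setT).

Local Notation vt := (vt gd p act).
Local Notation s := (src gd).
Local Notation r := (rng gd).

Context (I : countType) (B : I -> set X).
Context (BO : forall n, exists i, B i = O n).
Context (BC : forall i, exists j, B j = ~` B i).
Context (BI : forall i j, exists k, B k = B i `&` B j).
Context (Bvt : forall i n, exists j, B j = vt (B i) (U n)).
Context (Brank : forall i, exists a, Sigma0 a (B i)).
Context (E : I -> nat -> set X) (Eres : forall i, resolution (B i) (E i)).
Context (BE : forall i k, exists j, B j = E i k).

Definition vt_family (a : I * nat) : set X := vt (B a.1) (U a.2).
Local Notation W := vt_family.

Let act_id x : act (p x) x = x.
Proof. exact: (gact_id (pgsp_action hX)). Qed.

(** By continuity of [(g, y) -> g^-1 y] at [(p x, x)], a point that some arrow of a small [U n]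
    sends into a small [O m] lies in [V]. *)
Lemma vt_family_finer V x : open V -> V x -> exists2 a, W a x & W a `<=` V.
Proof.
move=> Vo Vx.
have px : ginv gd (p x) = p x.
  have xg := src_anchor hX x; have rx := rng_anchor hX x.
  have := comp_ginvl gd (p x); rewrite xg -{2}rx -src_ginv comp_src => ->.
  by [].
have [||P [N [Po No Px Nx PN]]] := @actV_nbhs _ _ _ hG _ _ _ hX (p x) x V _ Vo.
- exact: rng_anchor hX x.
- by rewrite px act_id.
have [n Unx UnP] := Ub.2 _ _ Po Px.
have [m Omx OmN] := Ob.2 _ _ No Nx.
have [i Bi] := BO m.
exists (i, n); rewrite /vt_family /= Bi.
  apply: (vt_open_set hG hX (Ob.1 m) (Ub.1 n) Unx); first exact: src_anchor hX x.
  by rewrite act_id.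
move=> y /vt_nonempty[g [Ug gy Og]]; rewrite -(actK hX gy).
by apply: PN; [exact: UnP|exact: OmN|rewrite (anchor_act hX)].
Qed.

Lemma vt_family_cover x : exists a, W a x.
Proof. by have [a Wa _] := @vt_family_finer setT x openT Logic.I; exists a. Qed.

(** Transforms are almost invariant under arrows near the identity [p x]: [vt_factor] yields the
    passage from [U i] to [V], and [vt_act_nbhs] the one from [U j] to [U i]. *)
Lemma vt_identity_nbhs A V x : open V -> vt A V x -> exists i j N,
  [/\ open N, N (p x), vt A (U j) x,
      forall g y, N g -> s g = p y -> vt A (U j) y -> vt A (U i) (act g y) &
      forall g y, N g -> s g = p y -> vt A (U i) (act g y) -> vt A V y].
Proof.
move=> Vo xV; have xg := src_anchor hX x.
have [i [N1 [N1o N1x]]] := vt_factor hG hX Ub Vo xg xV.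
rewrite act_id => xi iN1.
have [|j [N2 [N2o N2x xj jN2]]] := @vt_act_nbhs _ _ _ hG _ _ _ hX U Ub A (U i) (p x) x (Ub.1 i) xg.
  by rewrite act_id.
exists i, j, (N1 `&` N2); split=> //; first exact: openI.
  by move=> g y [_ N2g]; exact: jN2.
move=> g y [N1g _] gy m; apply: (vt_factor_act hG hX gy m) => k Uk kg.
exact: iN1.
Qed.

(** Intersecting two transforms and transforming again over a small neighborhood of [p x] gives a
    set that still contains [x] and lies in both original sets. *)
Lemma vt_family_join a b x : W a x -> W b x -> exists2 c, W c x & W c `<=` W a `&` W b.
Proof.
move=> Wa Wb.
have [i [j [N [No Nx xj jN Ni]]]] := vt_identity_nbhs (Ub.1 a.2) Wa.
have [i' [j' [N' [N'o N'x xj' jN' N'i]]]] := vt_identity_nbhs (Ub.1 b.2) Wb.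
have [k Bk] := Bvt a.1 i; have [k' Bk'] := Bvt b.1 i'.
have [l Bl] := BI k k'.
have [n Unx UnN] := Ub.2 _ _ (openI No N'o) (conj Nx N'x).
exists (l, n); rewrite /vt_family /= Bl Bk Bk'.
  apply: (vt_all hG hX (Ub.1 n) Unx) => g Ug gx.
  have [Ng N'g] := UnN _ Ug.
  by split; [exact: jN|exact: jN'].
move=> y /vt_nonempty[g [/UnN[Ng N'g] gy [m m']]].
by split; [exact: Ni m|exact: N'i m'].
Qed.

Context (t : Topological X).
Local Notation Xt := (Topological.Pack t).
Context (tb : @indexed_basis Xt _ W).

Lemma refined_finer (V : set X) : open V -> @open Xt V.
Proof.
move=> Vo; rewrite (@openE Xt) => x Vx.
have [a Wa aV] := vt_family_finer Vo Vx.
apply: (@filterS Xt _ _ (W a)) => //; apply: open_nbhs_nbhs; split=> //.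
exact: tb.1.
Qed.

(** Serves the given [V], which need not belong to the basis [U]: a concentration point localizes
    the transform to some [U n] inside [V]. *)
Lemma refined_vt i V : open V -> @open Xt (vt (B i) V).
Proof.
move=> Vo; rewrite (@openE Xt) => x /[dup] xV /(vt_point Ub)[g [gx Vg _ gO]].
have [n Ung UnV] := Ub.2 _ _ Vo Vg.
apply: (@filterS Xt _ _ (W (i, n))).
  by move=> y; apply: vtS.
apply: open_nbhs_nbhs; split; first exact: tb.1.
by apply: vtS (gO _ (Ub.1 n) Ung) => // h [].
Qed.

Lemma refined_regular : regular_space Xt.
Proof.
move=> x N Nx; have := Nx; rewrite {1}nbhsE => -[V [Vo Vx] VN].
have [[i0 n0] Wx WV] := tb.2 x V Vo Vx.
have [i [j [M [Mo Mx xj jM Mi]]]] := vt_identity_nbhs (Ub.1 n0) Wx.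
have [n Unx UnM] := Ub.2 _ _ Mo Mx.
have [k Bk] := Bvt i0 i; have [l Bl] := BC k.
have [Q Qo [Qx QU]] := anchor_nbhs hX (Ub.1 n) Unx.
have [m Omx OmQ] := regular_open_basis Ob (polish_regular (pgsp_polish hX)) Qo Qx.
(* The factor [O m] forces [p y] into [U n] for [y] in the closure. The factor [W (i0, j)] is
   disjoint from the open set [W (l, n)], so its closure is as well. *)
exists (W (i0, j) `&` O m).
  apply: (@filterI Xt _ (@nbhs_filter Xt x)); apply: (@open_nbhs_nbhs Xt);
    split=> //; first exact: tb.1.
  exact: refined_finer (Ob.1 m).
move=> y yc; apply/VN/WV.
have Uny : U n (p y).
  apply/QU/OmQ => C nC; have [|z [[_ Omz] Cz]] := yc C; last by exists z.
  move: nC; rewrite nbhsE => -[D [Do Dy] DC].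
  by rewrite nbhsE; exists D => //; split=> //; exact: refined_finer.
have nWl : ~ W (l, n) y.
  move=> Wl; have [|z [[zW _] zl]] := yc (W (l, n)).
    by apply: open_nbhs_nbhs; split=> //; exact: tb.1.
  have [g [Ug gz]] := @vt_nonempty _ gd X p act _ _ z zl.
  rewrite Bl Bk; apply; apply: jM => //; exact: UnM.
(* If every arrow of [U n] at [y] sent [y] outside [B k], then [y] would lie in [W (l, n)]. *)
have [g [Ug gy gW]] : exists g, [/\ U n g, s g = p y & vt (B i0) (U i) (act g y)].
  apply: contrapT => ng; apply/nWl/(vt_all hG hX (Ub.1 n) Uny) => g Ug gy.
  by rewrite /= Bl Bk => gW; apply: ng; exists g.
exact: (Mi g y (UnM _ Ug) gy gW).
Qed.

Lemma refined_continuous_action : @continuous_action G Xt gd p act.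
Proof.
split.
  apply/(@open_continuousP Xt) => x V Vo Vx.
  have [A Ao [Ax AV]] := anchor_nbhs hX Vo Vx.
  by exists A => //; exact: refined_finer.
apply/(@within_prodP G Xt Xt) => g x /= gx V Vo Vgx.
have [[i n] Wgx WV] := tb.2 _ V Vo Vgx.
have [j [N [No Ng xj jN]]] := vt_act_nbhs hG hX Ub (Ub.1 n) gx Wgx.
exists N, (W (i, j)); split=> //; first exact: tb.1.
by move=> h y Nh Wy hy; apply/WV/jN.
Qed.

(** One step of the generic construction: the condition [a] shrinks to [c] in [G] and in [X],
    decides [b], and records through [l] a factor of [a']. The sieve of [G] lives on [S0]. *)
Lemma vt_refine (prec : nat -> set G -> set G -> Prop) (precX : nat -> set X -> set X -> Prop)
    a a' n S0 o b x :
  (forall n A z, open A -> A z -> S0 z ->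
    exists2 N, open N & N z /\ forall A', A' `<=` N -> prec n A' A) ->
  (forall n A z, open A -> A z ->
    exists2 N, open N & N z /\ forall A', A' `<=` N -> precX n A' A) ->
  U a.2 `<=` S0 -> B a.1 `<=` O o -> W a x -> W a' x ->
  exists c o', W c x /\
    [/\ B c.1 `<=` B a.1 `&` O o', prec n (U c.2) (U a.2), precX n (O o') (O o),
        B c.1 `<=` ~` B b \/ exists k, B c.1 `<=` E b k &
        exists2 l, B c.1 `<=` vt (B a'.1) (U l) &
          forall g h, U l g -> U c.2 h -> s g = r h -> U a'.2 (Defs.comp gd g h)].
Proof.
move=> precG precO aS ao Wa Wa'.
(* [None] stands for the decision that puts the new condition outside [B b]. *)
pose Eb (k : option nat) := if k is Some k then E b k else ~` B b.
pose D (k : nat * option nat) :=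
  if pselect (precX n (O k.1) (O o)) then B a.1 `&` O k.1 `&` Eb k.2 else set0.
have aD : B a.1 `<=` \bigcup_k D k.
  move=> y By; have [N No [Ny NP]] := precO n _ y (Ob.1 o) (ao _ By).
  have [o' Oy o'N] := Ob.2 _ _ No Ny.
  have [k Ek] : exists k, Eb k y.
    have [Bby|nB] := pselect (B b y); last by exists None.
    have [BbE _ _] := Eres b; move: Bby; rewrite BbE => -[k _ Ek].
    by exists (Some k).
  exists (o', k) => //; rewrite /D; case: pselect => [pr|[]] /=; [by []|exact: NP].
(* Countably many pieces [D] cover [B a.1], so one of them is nonmeager along [U a.2] at [x]. *)
have [[o' k] xD] : exists k, vt (D k) (U a.2) x by apply: vt_bigcup; exact: vtS Wa.
have [Dp|nDp] := pselect (precX n (O o') (O o)); last first.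
  have [g [_ _]] := vt_nonempty xD; rewrite /D; case: pselect => //=.
have DE : D (o', k) = B a.1 `&` O o' `&` Eb k by rewrite /D; case: pselect.
rewrite DE in xD.
(* Localizing at one arrow [g] allows [U m] to shrink into any neighborhood of [g]. *)
have [g [gx Ug _ gO]] := vt_point Ub xD.
have [N0 N0o [N0g N0P]] := precG n _ g (Ub.1 a.2) Ug (aS _ Ug).
have [l [N1 [N1o N1g gl lN1]]] := vt_factor hG hX Ub (Ub.1 a'.2) gx Wa'.
have [j [N2 [N2o N2g xj jN2]]] := vt_act_nbhs hG hX Ub (Ub.1 l) gx gl.
have [m Umg UmN] := Ub.2 _ _ (openI (openI N0o N1o) N2o) (conj (conj N0g N1g) N2g).
have [e Ee] : exists e, B e = Eb k by case: k {xD DE gO} => [k|] /=; [exact: BE|exact: BC].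
have [i1 Bi1] := Bvt a'.1 l; have [i2 Bi2] := BO o'.
have [i3 Bi3] := BI a.1 i2; have [i4 Bi4] := BI i3 e; have [i5 Bi5] := BI i4 i1.
have Bi : B i5 = (B a.1 `&` O o' `&` Eb k) `&` vt (B a'.1) (U l).
  by rewrite Bi5 Bi4 Bi3 Bi2 Ee Bi1.
exists (i5, m), o'; split.
  rewrite /vt_family /= Bi => mg; apply: (gO _ (Ub.1 m) Umg); apply: meager_inS mg.
  move=> h [/= hx [[_ Uh] Dh]]; split=> //; split=> //.
  by apply: jN2 => //; have [_] := UmN _ Uh.
rewrite /= Bi; split=> //.
- by move=> y [[]].
- by apply: N0P => h /UmN[[]].
- by case: k {xD DE gO Ee Bi} => [k|] /=; [right; exists k|left] => y [[]].
- exists l => [y []//|h h' Uh /UmN[[_ N1h'] _]]; exact: lN1.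
Qed.

Lemma refined_polish : polish R Xt.
Proof.
have [precX [precXs precXo precXc]] := sieve_complete_space (pgsp_polish hX).
(* [G] is only locally Polish, so the sieve depends on the index [u] of the first condition; the
   whole construction stays inside [U u]. *)
have /choice[prec precP] : forall u, exists prec : nat -> set G -> set G -> Prop,
  [/\ forall n A A', prec n A A' -> A `<=` A',
      forall n A z, open A -> A z -> U u z ->
        exists2 N, open N & N z /\ forall A', A' `<=` N -> prec n A' A &
      forall A : nat -> set G, (forall n, A n `&` U u !=set0) ->
        (forall n, prec n (A n.+1) (A n)) ->
        exists2 z, U u z & (forall n, A n z) /\
          forall N, open N -> N z -> exists n, A n `&` U u `<=` N].
  by move=> u; exact: Uc.
pose J := (I * nat)%type.
pose good (n : nat) (u : nat) (b : I) (a' : J) (o : nat) (a : J) (o' : nat) (c : J) :=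
  [/\ B c.1 `<=` B a.1 `&` O o', prec u n (U c.2) (U a.2), precX n (O o') (O o),
        B c.1 `<=` ~` B b \/ exists k, B c.1 `<=` E b k &
        exists2 l, B c.1 `<=` vt (B a'.1) (U l) &
          forall g h, U l g -> U c.2 h -> s g = r h -> U a'.2 (Defs.comp gd g h)].
pose K := (nat * nat * I * J * nat * J)%type.
(* A filter with [W a] and [W a'] has to contain a refinement of [a] as in [vt_refine]. When the
   hypotheses of that lemma fail, [A c] is empty and nothing is demanded. *)
pose A (c : K) : set X := let: (n, u, b, a', o, a) := c in
  if pselect (U a.2 `<=` U u /\ B a.1 `<=` O o) then W a `&` W a' else set0.
pose C (c : K) : set J := let: (n, u, b, a', o, a) := c in
  [set j | exists o', good n u b a' o a o' j].
apply: (@polish_of_conditions R Xt J K W A C tb refined_regular).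
- move=> x y xy; apply: (polish_hausdorff (pgsp_polish hX)) => N1 N2.
  rewrite !nbhsE => -[V1 [V1o V1x] VN1] [V2 [V2o V2y] VN2].
  by exists y; split; [exact: VN1 (xy _ (refined_finer V1o) V1x)|exact: VN2].
- move=> [[[[[n u] b] a'] o] a] x /=; case: pselect => //= -[au ao] [Wa Wa'].
  have [_ pO _] := precP u.
  have pXo m V z Vo Vz := precXo m V z Vo Vz Logic.I.
  have [c [o' [Wc cP]]] := vt_refine n b pO pXo au ao Wa Wa'.
  by exists c => //; exists o'.
move=> Phi PhiP PhiC.
(* A filter without basic sets is realized vacuously by any point. *)
have [[a0 Wa0]|noW] := pselect (exists a, Phi (W a)); last first.
  have [x _] := filter_ex (@filterT _ Phi _).
  by exists x => a Wa; case: noW; exists a.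
pose u := a0.2.
pose Inv (st : J * nat) := [/\ Phi (W st.1), U st.1.2 `<=` U u & B st.1.1 `<=` O st.2].
(* Stage [n] decides the index coded by [n], and treats the pair coded by [n] if [Phi] contains its
   set; otherwise the choice is free. *)
pose rel n (st st' : J * nat) := exists b a',
  [/\ good n u b a' st.2 st.1 st'.2 st'.1, forall b', unpickle n = Some b' -> b = b' &
      forall a'', unpickle n = Some a'' -> Phi (W a'') -> a' = a''].
have [||st [_ stI stR]] := @dependent_sequence _ Inv rel (a0, 0%N).
- by split=> //=; rewrite OT.
- move=> n [a o] [/= Wa aU aO].
  pose b := odflt a.1 (unpickle n).
  have [a' [Wa' a'P]] : exists a', Phi (W a') /\
      forall a'', unpickle n = Some a'' -> Phi (W a'') -> a' = a''.
    case na: (unpickle n : option J) => [a''|]; last by exists a; split=> // a''.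
    have [Wa''|nW] := pselect (Phi (W a'')).
      by exists a''; split=> // ? [].
    by exists a; split=> // ? [<-].
  have [|c [o' co'] Wc] := PhiC (n, u, b, a', o, a).
    by rewrite /A; case: pselect => [_|[]//] /=; exact: filterI.
  exists (c, o'); split.
    have [ca ua _ _ _] := co'; split=> //=; last by move=> y /ca[].
    by have [ps _ _] := precP u; apply: subset_trans aU; exact: ps ua.
  exists b, a'; split=> // b'; by rewrite /b => ->.
pose Bn n := B (st n).1.1; pose Un n := U (st n).1.2; pose On n := O (st n).2.
have Bdec n m : (n <= m)%N -> Bn m `<=` Bn n.
  elim: m => [|m IH]; first by rewrite leqn0 => /eqP->.
  rewrite leq_eqVlt => /orP[/eqP->//|]; rewrite ltnS => /IH; apply: subset_trans.
  by have [b [a' [[ca _ _ _ _] _ _]]] := stR m; move=> y /ca[].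
have [precs _ precc] := precP u.
have Udec n m : (n <= m)%N -> Un m `<=` Un n.
  elim: m => [|m IH]; first by rewrite leqn0 => /eqP->.
  rewrite leq_eqVlt => /orP[/eqP->//|]; rewrite ltnS => /IH; apply: subset_trans.
  by have [b [a' [[_ ua _ _ _] _ _]]] := stR m; exact: precs ua.
have pt n : exists g x, [/\ Un n g, s g = p x & Bn n (act g x)].
  have [Wn _ _] := stI n; have [x xW] := filter_ex Wn.
  by have [g gP] := @vt_nonempty _ gd X p act _ _ x xW; exists g, x.
have Bne n : Bn n !=set0 by have [g [x [_ _ Bg]]] := pt n; exists (act g x).
have BOn n : Bn n `<=` On n by have [] := stI n.
have [||g ug [Ung gnb]] := precc Un.
- move=> n; have [g [x [Ug _ _]]] := pt n; exists g; split=> //.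
  by have [_ + _] := stI n; apply.
- by move=> n; have [b [a' [[]]]] := stR n.
have [||y _ [Ony ynb]] := precXc On.
- by move=> n; have [y By] := Bne n; exists y; split=> //; exact: BOn.
- by move=> n; have [b [a' [[]]]] := stR n.
have gU n : Un n `<=` U u by have [_ + _] := stI n.
(* Arrows [h] of [Un n] with [h x] in [Bn n] satisfy [r h = p (h x)], so [r g] and [p y] have no
   disjoint neighborhoods. The argument runs in the space of objects, since [G] need not be
   Hausdorff. *)
have ry : r g = p y.
  apply: contrapT => neq.
  pose ob z (zP : objects gd z) : set_type (objects gd) := exist _ z (mem_set zP).
  have rg : objects gd (r g) by exact: src_rng.
  have py : objects gd (p y) by exact: src_anchor hX y.
  apply: neq; suff /(congr1 val) : ob _ rg = ob _ py by [].
  apply: (polish_hausdorff (pgpd_objects_polish hG)) => N1 N2.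
  rewrite !nbhsE => -[V1 [[P1 P1o P1V] V1z] VN1] [V2 [[P2 P2o P2V] V2z] VN2].
  have P1g : P1 (r g) by move: V1z; rewrite -P1V /= set_valE.
  have P2y : P2 (p y) by move: V2z; rewrite -P2V /= set_valE.
  have /open_continuousP := rng_continuous hG.
  move=> /(_ g P1 P1o P1g)[M1 M1o [M1g M1P]].
  have [M2 M2o [M2y M2P]] := anchor_nbhs hX P2o P2y.
  have [n1 n1M] := gnb M1 M1o M1g; have [n2 n2M] := ynb M2 M2o M2y.
  have [h [x [Uh hx Bh]]] := pt (maxn n1 n2).
  have P1h : P1 (r h).
    by apply/M1P/n1M; split; [apply: Udec Uh; exact: leq_maxl|exact: gU Uh].
  have P2h : P2 (r h).
    rewrite -(anchor_act hX hx); apply/M2P/n2M; split=> //.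
    by apply: BOn; apply: Bdec Bh; exact: leq_maxr.
  have oh : objects gd (r h) by exact: src_rng.
  exists (ob _ oh); split.
    by apply: VN1; rewrite -P1V /= set_valE.
  by apply: VN2; rewrite -P2V /= set_valE.
have decided b : exists n, Bn n `<=` ~` B b \/ exists k, Bn n `<=` E b k.
  exists (pickle b).+1; have [b' [a' [[_ _ _ dec _] bb _]]] := stR (pickle b).
  by have eb : b' = b; [apply: bb; rewrite pickleK|rewrite eb in dec].
have Bdir n m : exists z, Bn n z /\ Bn m z.
  have [z Bz] := Bne (maxn n m); exists z.
  by split; apply: Bdec Bz; [exact: leq_maxl|exact: leq_maxr].
(* Genericity of [y], by induction on the rank of [B b]. *)
have forcing b : B b y <-> exists n, Bn n `<=` B b.
  have [a aB] := Brank b.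
  elim/(well_founded_ind om_lt_wf): a b aB => a IH b aB.
  have [BbE Eo Eno] := Eres b.
  have Ey k : Bn k `<=` B b -> exists n j, Bn n `<=` E b j.
    move=> kB; have [n [nB|[j nE]]] := decided b; last by exists n, j.
    by have [z [/kB ? /nB]] := Bdir k n.
  have [Bo|nBo] := pselect (open (B b)).
    split=> [By|[k /Ey[n [j nE]]]].
      have [n nB] := ynb _ Bo By; exists n => z Bz; apply: nB; split=> //.
      exact: BOn.
    (* Here [y] is only known to lie in the closure of [Bn n]; this is why the pieces of an open set
       have their closures inside it. *)
    have [_ + ] := Eo Bo j; apply; apply: closureS nE _ _ => N.
    rewrite nbhsE => -[V [Vo Vy] VN]; have [m mV] := ynb _ Vo Vy.
    have [z [nz mz]] := Bdir n m; exists z; split=> //.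
    by apply/VN/mV; split=> //; exact: BOn.
  (* The complement of a piece belongs to the family and has lower rank, so the induction hypothesis
     applies to it. *)
  have EC k : (~` E b k) y <-> exists n, Bn n `<=` ~` E b k.
    have [i Bi] := BE b k; have [j Bj] := BC i.
    have [c ca cE] := Eno nBo a aB k.
    by rewrite -Bi -Bj; apply: (IH c) => //; rewrite Bj Bi.
  split=> [By|[k /Ey[n [j nE]]]].
    have [n [nB|[j nE]]] := decided b; last first.
      by exists n => z /nE Ez; rewrite BbE; exists j.
    (* If [Bn n] missed [B b], it would lie in the complement of every piece, and hence so would
       [y]. *)
    move: (By); rewrite {1}BbE => -[k _ Ey'].
    have : (~` E b k) y.
      by apply/EC; exists n => z /nB nBz Ez; apply: nBz; rewrite BbE; exists k.
    by [].
  rewrite BbE; exists j => //; apply: contrapT => /EC[m mE].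
  by have [z [/nE ? /mE]] := Bdir n m.
pose x := act (ginv gd g) y.
have gx : s g = p x by rewrite /x (anchor_act hX) ?rng_ginv// src_ginv.
have gxy : act g x = y by rewrite /x (actKV hX).
(* The stage that treated [(i, n)] left a set [U l] such that [y = g x] is in the transform of [B i]
   for [U l], while products of arrows of [U l] with [g] lie in [U n]. *)
exists x => -[i n] Wi; have [b [a' [[_ _ _ _ [l lB lU]] _ aa]]] := stR (pickle (i, n)).
move: lB lU; rewrite (aa (i, n)) ?pickleK//= => lB lU.
apply: (@vt_factor_act _ _ _ hG _ _ _ hX (B i) (U n) (U l) g x gx).
  rewrite gxy; have [e Be] := Bvt i l; rewrite -Be; apply/forcing.
  by exists (pickle (i, n)).+1; rewrite Be.
move=> k Uk kg; apply: lU => //; exact: (Ung (pickle (i, n)).+1).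
Qed.

End refined_topology.

(** * Choice of the countable family and conclusion *)

Theorem theorem4p2 (R : realType)
    (G : topologicalType) (gd : groupoid G) (hG : polish_groupoid R gd)
    (X : topologicalType) (p : X -> G) (act : G -> X -> X)
    (hX : polish_gspace R gd p act)
    (V : set G) (hVopen : open V) (hVpolish : polish_set R V)
    (alpha : omega1) (halpha : om_le om_one alpha)
    (P : set X) (hP : Sigma0 alpha P)
    (Q : set X) (hQ : Q = vaught gd p act P V) :
  exists t : Topological X, let Xt : topologicalType := Topological.Pack t in
    [/\ polish R Xt,
        (forall U : set X, open U -> @open Xt U),
        @open Xt Q,
        @continuous_action G Xt gd p act &
        exists2 B : set (set X), countable B &
          @basis Xt B /\
          (forall U : set X, B U -> exists n : nat, Sigma0 (om_addn alpha n) U)].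
Proof.
have [U Ub Uc] := locally_polish_basis (pgpd_locally_polish hG).
have [O0 O0b] := polish_basis (pgsp_polish hX).
have Xreg := polish_regular (pgsp_polish hX).
(* The whole space comes first because it starts the sequence of sets [O] in the generic
   construction. *)
pose O n := if n is m.+1 then O0 m else setT.
have Ob : indexed_basis O.
  split=> [[|n]|x A Ao Ax]; [exact: openT|exact: O0b.1|].
  by have [n nx nA] := O0b.2 x A Ao Ax; exists n.+1.
(* Resolutions are chosen for all sets at once, with a junk value off the Borel sets, so that taking
   a piece becomes an operation that can be iterated. *)
have /choice[res resP] : forall A : set X, exists E, (exists a, Sigma0 a A) -> resolution A E.
  move=> A; have [[a aA]|na] := pselect (exists a, Sigma0 a A).
    by have [E AE] := exists_resolution Ob Xreg aA; exists E.
  by exists (fun=> set0).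
pose s n := if n is m.+1 then O m else P.
pose f (j : unit + nat + nat) (A : set X) := match j with
  | inl (inl _) => ~` A | inl (inr n) => vt gd p act A (U n) | inr k => res A k end.
pose B := closure_term s f setI.
(* Above [alpha], complements and pieces of a resolution cost one level, intersections two, and
   transforms none. *)
have lev i : exists n, Sigma0 (om_addn alpha n) (B i).
  have a1 n : om_le om_one (om_addn alpha n).
    exact: om_le_trans halpha (om_le_addn alpha (leq0n n)).
  apply: (@closure_term_ind _ _ s f setI (fun A => exists n, Sigma0 (om_addn alpha n) A))
    => {i} [[|n]|j A [n nA]|A A' [n nA] [m mA']]; first by exists 0%N.
  - by exists 0%N; apply: (open_Sigma0 Ob Xreg) => //; exact: Ob.1.
  - case: j => [[_|m]|k] /=.
    + by exists n.+1; exact: Sigma0C.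
    + by exists n; exact: (Sigma0_vt hG hX Ub Ob).
    + exists n.+1; have [|_ Eo Eno] := resP A; first by exists (om_addn alpha n).
      have [Ao|nAo] := pselect (open A).
        by apply: (open_Sigma0 Ob Xreg) => //; exact: (Eo Ao k).1.
      have [b ba bE] := Eno nAo _ nA k.
      rewrite -[res A k]setCK; apply/Sigma0C/(Sigma0_le Ob Xreg _ bE).
      exact: om_le_trans (om_le_succ b) ba.
  - exact: ex_intro (Sigma0I Ob Xreg nA mA').
have BO n : exists i, B i = O n by exists (GenTree.Leaf n.+1).
have BC i : exists j, B j = ~` B i by exact: (closure_term_f s f setI (inl (inl tt)) i).
have Bvt i n : exists j, B j = vt gd p act (B i) (U n).
  exact: (closure_term_f s f setI (inl (inr n)) i).
have BE i k : exists j, B j = res (B i) k by exact: (closure_term_f s f setI (inr k) i).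
have BI i j : exists k, B k = B i `&` B j by exact: (closure_term_h s f setI i j).
have Brank i : exists a, Sigma0 a (B i) by have [n Bn] := lev i; exists (om_addn alpha n).
have Eres i : resolution (B i) (res (B i)) by exact: resP.
have [t tb] := topology_of_basis
  (vt_family_cover hG hX Ub Ob BO) (vt_family_join hG hX Ub BI Bvt).
exists t => /=; split.
- exact: (refined_polish hG hX Ub Uc Ob erefl BO BC BI Bvt Brank Eres BE tb).
- exact: (refined_finer hG hX Ub Ob BO tb).
- rewrite hQ (vaughtE _ _ _ _ hVopen).
  (* The leaf 0 is the term whose value is [P]. *)
  exact: (refined_vt Ub tb (GenTree.Leaf 0) hVopen).
- exact: (refined_continuous_action hG hX Ub Ob BO tb).
exists (range (vt_family gd p act U B)).
  by apply: (sub_countable (card_image_le _ _)); exact: countableP.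
split; last first.
  by move=> _ [[i n] _ <-]; have [m Bm] := lev i; exists m; exact: (Sigma0_vt hG hX Ub Ob).
apply/(@basisP (Topological.Pack t)); split=> [_ [a _ <-]|x A Ao Ax]; first exact: tb.1.
by have [a ax aA] := tb.2 x A Ao Ax; exists (vt_family gd p act U B a) => //; exists a.
Qed.
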